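(* Let $n\ge1$, $\mathfrak{gl}=\mathfrak{gl}(n+1|n)$ with $I=\{1,\dots,2n+1\}$, $p(i)=0$ for odd $i$, $p(i)=1$ for even $i$, grading $e_{ij}\in\mathfrak{gl}_{(j-i)/2}$, $f=\sum_{i=1}^{2n}e_{i+1,i}$, and let $w_1,\dots,w_{2n+1}\in\mathcal V(\bar{\mathfrak q})$, $\mathfrak q=\mathfrak{gl}_{\le0}$, be defined by $\operatorname{rdet}(\mathcal A)=\sum_{i=0}^{2n+1}w_{2n+1-i}D^i$, where $\mathcal A_{ij}=\delta_{ij}D+\bar e^{\,ji}$ ($i\le j$), $\mathcal A_{i+1,i}=-1$, other entries $0$, and $e^{ji}=(-1)^{p(j)}e_{ji}$. Let $\mathfrak g=\mathfrak{sl}(n+1|n)=\{X\in\mathfrak{gl}:\operatorname{str}X=0\}$ with the induced grading, $\mathfrak p=\mathfrak g_{\le0}$ (so $\mathfrak q=\mathfrak p\oplus\mathbb CI$, $I$ the identity matrix), and let $\pi_{\mathfrak{sl}}:\mathcal V(\bar{\mathfrak q})\to\mathcal V(\bar{\mathfrak p})$ be the differential algebra homomorphism induced by $\bar X\mapsto\overline{X-\operatorname{str}(X)I}$. Then $$\mathcal W(\bar{\mathfrak g},f)=\mathbb C\big[\pi_{\mathfrak{sl}}(w_i)^{(m)}\mid i=2,\dots,2n+1,\ m\in\mathbb Z_{\ge0}\big].$$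
   Context: $\mathfrak{gl}$ is spanned by matrix units $e_{ij}$ of parity $p(i)+p(j)$, $[e_{ij},e_{kl}]=\delta_{jk}e_{il}-(-1)^{(p(i)+p(j))(p(k)+p(l))}\delta_{il}e_{kj}$, $\operatorname{str}(\sum a_{ij}e_{ij})=\sum(-1)^{p(i)}a_{ii}$, form $(X|Y)=\operatorname{str}(XY)$ (restricted to $\mathfrak{sl}$ for $\mathfrak g$). For $\mathfrak a$ with even supersymmetric invariant form, $\bar{\mathfrak a}$ is a parity-reversed copy ($p(\bar a)=p(a)+1$); $\mathcal V(\bar{\mathfrak a})=S(\mathbb C[D]\otimes\bar{\mathfrak a})$ is the free supercommutative algebra on $D^m\bar a$ with odd derivation $D$ and the SUSY PVA bracket $\{\bar a{}_\chi\bar b\}=(-1)^{p(a)(p(b)+1)}\overline{[a,b]}+\chi(a|b)$ extended by sesquilinearity $\{Dx{}_\chi y\}=-\chi\{x{}_\chi y\}$, $\{x{}_\chi Dy\}=(-1)^{p(x)+1}(D+\chi)\{x{}_\chi y\}$ and the Leibniz rule $\{x{}_\chi yz\}=(-1)^{(p(x)+1)p(y)}y\{x{}_\chi z\}+\{x{}_\chi y\}z$; $\chi$ odd, supercommuting with $\mathcal V$, $D\chi+\chi D=-2\chi^2$. $x^{(m)}=D^mx$. For a grading $\mathfrak g=\bigoplus_j\mathfrak g_j$ and odd $f\in\mathfrak g_{-1/2}$: $\mathfrak n=\mathfrak g_{>0}$, $\mathfrak p=\mathfrak g_{\le0}$, $\mathfrak J$ = differential ideal of $\mathcal V(\bar{\mathfrak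 g})$ generated by $\bar n-(f|n)$, $n\in\mathfrak n$, and $\mathcal W(\bar{\mathfrak g},f)=\{w\in\mathcal V(\bar{\mathfrak p}):\{\bar n{}_\chi w\}\in\mathbb C[\chi]\otimes\mathfrak J\ \forall n\in\mathfrak n\}$. In $\mathcal V[D]$, $D\,a=D(a)+(-1)^{p(a)}aD$, coefficients written on the left. $\operatorname{rdet}(A)=\sum_{\sigma\in S_N}\operatorname{sgn}(\sigma)A_{1\sigma(1)}\cdots A_{N\sigma(N)}$. *)

(* Defs.v *)
From HB Require Import structures.
From mathcomp Require Import all_boot all_order all_algebra all_fingroup.
Set Implicit Arguments. Unset Strict Implicit. Unset Printing Implicit Defensive.
Import GRing.Theory.
Local Open Scope ring_scope.

(* Generic part: free supercommutative algebra S(C[D] (x) a-bar) over K,     *)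
(* a-bar having basis B, where pB b is the parity of the basis element b of  *)
(* a (so the generator D^m b-bar has parity pB b + 1 + m).                   *)
(* Elements are formal K-linear combinations of words in the generators;    *)
(* two formal sums denote the same element iff they have the same           *)
(* coefficients on the standard (sorted) monomial basis, computed by coef:   *)
(* a word equals sgnw w times its sorted rearrangement, where sgnw counts    *)
(* inversions among odd letters, and is 0 if an odd letter repeats.         *)
Section SuperPoly.
Variables (K : fieldType) (B : finType) (pB : B -> bool).

Definition gen := (B * nat)%type.                (* (b, m) = D^m b-bar *)
Definition pg (g : gen) : bool := pB g.1 (+) true (+) odd g.2.
Definition word := seq gen.
Definition pw (w : word) : bool := foldr addb false (map pg w).
Definition key (g : gen) : nat := pickle g.
Definition sortw (w : word) : word := sort (fun x y => (key x <= key y)%N) w.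
Fixpoint oinv (w : word) : nat :=
  match w with
  | [::] => 0%N
  | g :: w' => ((if pg g then count (fun h => pg h && (key h < key g)%N) w' else 0)
                + oinv w')%N
  end.
Definition sgnw (w : word) : K := if uniq (filter pg w) then (-1) ^+ oinv w else 0.

Definition V := seq (K * word).
Definition coef (x : V) (m : word) : K := \sum_(t <- x | sortw t.2 == m) t.1 * sgnw t.2.
Definition veq (x y : V) : Prop := forall m, coef x m = coef y m.

Definition vscale (c : K) (x : V) : V := [seq (c * t.1, t.2) | t <- x].
Definition vmul (x y : V) : V := [seq (s.1 * t.1, s.2 ++ t.2) | s <- x, t <- y].
Definition vone : V := [:: (1, [::])].
Definition vconst (c : K) : V := [:: (c, [::])].
Definition vgen (g : gen) : V := [:: (1, [:: g])].

Definition Dg (g : gen) : gen := (g.1, g.2.+1).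
Fixpoint Dword (w : word) : V :=
  match w with
  | [::] => [::]
  | g :: w' => (1, Dg g :: w') :: [seq ((-1) ^+ pg g * t.1, g :: t.2) | t <- Dword w']
  end.
Definition Dv (x : V) : V := flatten [seq vscale t.1 (Dword t.2) | t <- x].

(* C[chi] (x) V : formal sums of terms (j, (c, w)) = chi^j c w  (chi on the left).
   The same type is used for V[D] : (k, (c, w)) = c w D^k (coefficients on the left). *)
Definition CV := seq (nat * (K * word)).
Definition chicoef (X : CV) (j : nat) : V := [seq t.2 | t <- X & t.1 == j].
Definition cscale (c : K) (X : CV) : CV := [seq (t.1, (c * t.2.1, t.2.2)) | t <- X].
Definition chimul (X : CV) : CV := [seq (t.1.+1, t.2) | t <- X].
(* D acting on C[chi] (x) V, using D chi + chi D = -2 chi^2, i.e.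
   D chi^j = (-1)^j chi^j D + (if j odd then -2 else 0) chi^(j+1) *)
Definition chiD (X : CV) : CV :=
  flatten [seq [seq (t.1, u) | u <- vscale ((-1) ^+ odd t.1 * t.2.1) (Dword t.2.2)]
               ++ [:: (t.1.+1, ((if odd t.1 then -2 else 0) * t.2.1, t.2.2))] | t <- X].

(* The SUSY lambda-bracket {a-bar _chi . } for a basis element a of the Lie
   superalgebra, given the bracket lb a b = [a,b] in the basis and the form fm. *)
Variables (lb : B -> B -> seq (K * B)) (fm : B -> B -> K).

Definition base (a b : B) : CV :=
  [seq (0%N, ((-1) ^+ (pB a && ~~ pB b) * t.1, [:: (t.2, 0%N)])) | t <- lb a b]
  ++ [:: (1%N, (fm a b, [::]))].
(* {x_chi D y} = (-1)^(p(x)+1) (D + chi) {x_chi y}, p(x)+1 = pB a *)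
Definition brGen (a : B) (g : gen) : CV :=
  iter g.2 (fun X => cscale ((-1) ^+ pB a) (chiD X ++ chimul X)) (base a g.1).
(* left Leibniz rule, chi supercommuting with V *)
Fixpoint brWord (a : B) (w : word) : CV :=
  match w with
  | [::] => [::]
  | y :: r =>
      [seq (t.1, ((-1) ^+ ((pB a && pg y) (+) (odd t.1 && pg y)) * t.2.1, y :: t.2.2))
      | t <- brWord a r]
      ++ [seq (t.1, (t.2.1, t.2.2 ++ r)) | t <- brGen a y]
  end.
Definition brV (a : B) (x : V) : CV := flatten [seq cscale t.1 (brWord a t.2) | t <- x].

Definition opD (X : CV) : CV :=
  flatten [seq [seq (t.1, u) | u <- vscale t.2.1 (Dword t.2.2)]
               ++ [:: (t.1.+1, ((-1) ^+ pw t.2.2 * t.2.1, t.2.2))] | t <- X].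
Definition opmul (X Y : CV) : CV :=
  flatten [seq [seq (u.1, (t.2.1 * u.2.1, t.2.2 ++ u.2.2)) | u <- iter t.1 opD Y] | t <- X].
Definition opone : CV := [:: (0%N, (1, [::]))].

End SuperPoly.

(* gl(n+1|n) and sl(n+1|n); indices are 0-based: paper index i <-> i-1, so  *)
(* p(i) = odd i (0-based).                                                  *)
Section SL.
Variables (K : fieldType) (n : nat).

Definition NN : nat := n.*2.+1.
Definition par (i : 'I_NN) : bool := odd i.
Definition str (M : 'M[K]_NN) : K := \sum_i (-1) ^+ par i * M i i.

(* basis of gl: matrix units e_ij *)
Definition Bgl := ('I_NN * 'I_NN)%type.
HB.instance Definition _ := Finite.on Bgl.
Definition pgl (b : Bgl) : bool := par b.1 (+) par b.2.

(* basis of sl: e_ij (i <> j) and h_k = e_kk + e_(k+1)(k+1) *)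
Definition offd := {ij : 'I_NN * 'I_NN | ij.1 != ij.2}.
HB.instance Definition _ := [Finite of offd by <:].
Definition Bsl := (offd + 'I_(n.*2))%type.
HB.instance Definition _ := Finite.on Bsl.
Definition psl (b : Bsl) : bool :=
  match b with inl ij => par (sval ij).1 (+) par (sval ij).2 | inr _ => false end.
Definition slmat (b : Bsl) : 'M[K]_NN :=
  match b with
  | inl ij => delta_mx (sval ij).1 (sval ij).2
  | inr k => delta_mx (widen_ord (leqnSn _) k) (widen_ord (leqnSn _) k)
             + delta_mx (lift ord0 k) (lift ord0 k)
  end.
(* coordinates of a supertrace-zero matrix in this basis *)
Definition coord (X : 'M[K]_NN) (b : Bsl) : K :=
  match b with
  | inl ij => X (sval ij).1 (sval ij).2
  | inr k => \sum_(j < NN | (j <= k)%N) (-1) ^+ (k - j) * X j j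
  end.
Definition ovl (X : 'M[K]_NN) : seq (K * Bsl) := [seq (coord X b, b) | b <- enum {: Bsl}].

Definition slbr (a b : Bsl) : seq (K * Bsl) :=
  ovl (slmat a *m slmat b - (-1) ^+ (psl a && psl b) *: (slmat b *m slmat a)).
Definition slform (a b : Bsl) : K := str (slmat a *m slmat b).

Definition fmat : 'M[K]_NN := \sum_(i < NN | (i < n.*2)%N) delta_mx (inord i.+1) i.

(* n = g_{>0} is spanned by e_ij with i < j; p = g_{<=0} by the other basis elements *)
Definition nbas (b : Bsl) : bool :=
  match b with inl ij => ((sval ij).1 < (sval ij).2)%N | inr _ => false end.

Definition Vsl := V K Bsl.
Definition Vgl := V K Bgl.

(* the differential ideal J generated by n-bar - (f|n), n in n *)
Definition inJ (x : Vsl) : Prop :=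
  exists l : seq (Vsl * Bsl * nat),
    all (fun t => nbas t.1.2) l /\
    veq psl x (flatten [seq vmul t.1.1
                (@vgen K Bsl (t.1.2, t.2) ++
                 (if t.2 == 0%N then @vconst K Bsl (- str (fmat *m slmat t.1.2)) else [::]))
              | t <- l]).

Definition inVp (w : Vsl) : Prop :=
  forall m, coef psl w m != 0 -> all (fun g : gen Bsl => ~~ nbas g.1) m.

(* W(g-bar, f) membership (w in V(p-bar) is required separately) *)
Definition isW (w : Vsl) : Prop :=
  forall a, nbas a -> forall j, inJ (chicoef (brV psl slbr slform a w) j).

Definition Amat (i j : 'I_NN) : CV K Bgl :=
  if (i <= j)%N then
    (if i == j then [:: (1%N, (1, [::]))] else [::])
    ++ [:: (0%N, ((-1) ^+ par j, [:: ((j, i), 0%N)]))]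
  else if (i == j.+1 :> nat) then [:: (0%N, (-1, [::]))] else [::].

Definition rdet : CV K Bgl :=
  flatten [seq cscale ((-1) ^+ odd_perm s)
                 (foldr (opmul pgl) (opone K Bgl) [seq Amat i (s i) | i <- enum 'I_NN])
          | s <- enum {: {perm 'I_NN}}].

Definition wcoef (k : nat) : Vgl := [seq t.2 | t <- rdet & t.1 == (NN - k)%N].

Definition pigen (g : gen Bgl) : Vsl :=
  [seq (t.1, [:: (t.2, g.2)])
  | t <- ovl (delta_mx g.1.1 g.1.2 - str (delta_mx g.1.1 g.1.2) *: 1%:M)].
Definition piword (w : word Bgl) : Vsl := foldr (@vmul K Bsl) (vone K Bsl) (map pigen w).
Definition pisl (x : Vgl) : Vsl := flatten [seq vscale t.1 (piword t.2) | t <- x].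

Definition ugen (i m : nat) : Vsl := iter m (Dv psl) (pisl (wcoef i)).

Definition inGen (x : Vsl) : Prop :=
  exists l : seq (K * seq (nat * nat)),
    all (fun t => all (fun s => (2 <= s.1 <= NN)%N) t.2) l /\
    veq psl x (flatten [seq vscale t.1 (foldr (@vmul K Bsl) (vone K Bsl)
                                          [seq ugen s.1 s.2 | s <- t.2]) | t <- l]).

End SL.

(* Main.v *)
(* V(g-bar)/J is identified with V(p-bar) by a retraction rho, so that W consists of
   the common kernel in V(p-bar) of the superderivations rho o d_(a,j), where
   d_(a,j) x is the coefficient of chi^j in {a-bar _chi x} and a runs over e_kl,
   k < l.

   Coefficients of rdet(A) lie in W. Since A has -1 on its subdiagonal, there is a
   unique column P with last entry 1 and A P = (rdet A, 0, ..., 0). Modulo J the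
   bracket of e_kl with A is a twisted commutator with the elementary matrix E_kl,
   and E_kl is strictly upper triangular, so solving from the bottom row upwards
   gives that the bracket of rdet A is 0.

   They generate W. The coefficient w_(j+1) of rdet(A) is the first column entry
   e_j0 up to sign, plus terms in earlier entries of the first column and in the
   other columns. Hence V(p-bar) is generated by the pi(w_i)^(m), i >= 2, and the
   D^m e_ji with 1 <= i <= j; the element e_00 is recovered from the image 0 of the
   identity matrix. The bracket with e_(i-1)j lowers the weight by exactly that of
   e_ji. Ordering the D^m e_ji by weight, then by decreasing column, the chi^m
   coefficient of this bracket is a nonzero constant on D^m e_ji, vanishes on the
   smaller generators, and kills the pi(w_i)^(m). An element of W therefore cannot
   involve its largest such generator, and iterating leaves only the pi(w_i)^(m). *)

(* Why the first column is exceptional: for $i\ge1$ the bracket of $e_{i-1,j}$ with $\bar e_{ji}$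
   contains $\bar e_{i-1,i}$, which modulo J is the nonzero constant $(f|e_{i-1,i})$. For $i=0$
   there is no $e_{i-1,j}$, so no bracket can eliminate these entries, and they have to be traded
   for coefficients of rdet(A). The coefficient $w_1$ is $\bar I$ itself, whose image is 0; hence
   the list of generators starts at $i=2$. Sesquilinearity pairs $D^m$ with $\chi^m$. Removing one
   generator $y$ rests on two facts: [rho] is the identity on V(p-bar), so that $d=\rho\circ
   d_{a,m}$ satisfies the Leibniz rule there; and in characteristic zero $dx=0$ forces a polynomial
   $x$ in $y$, with coefficients killed by $d$ and $dy$ a nonzero constant, to be free of $y$. The
   definitions compare formal sums by coefficients. All computations take place in the quotient ring
   [spoly]; a linear map out of it is a map on words that respects the exchange of neighbouring
   letters. *)
Require Import Defs.
From HB Require Import structures.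
From mathcomp Require Import all_boot all_order all_algebra all_fingroup.
From mathcomp Require Import zify.
Set Implicit Arguments. Unset Strict Implicit. Unset Printing Implicit Defensive.
Import GRing.Theory Num.Theory.
Local Open Scope ring_scope.
Local Open Scope quotient_scope.

(** * The free supercommutative algebra as a quotient ring *)

Section Words.
Variables (K : numFieldType) (B : finType) (pB : B -> bool).
Notation gen := (gen B).
Notation word := (word B).
Notation pg := (pg pB).
Notation pw := (pw pB).
Notation sgnw := (sgnw K pB).

Lemma key_inj : injective (@key B).
Proof. exact: pcan_inj pickleK. Qed.

Lemma key_total : total (fun x y : gen => (key x <= key y)%N).
Proof. by move=> x y; exact: leq_total. Qed.

Lemma key_trans : transitive (fun x y : gen => (key x <= key y)%N).
Proof. by move=> x y z; exact: leq_trans. Qed.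

Lemma key_anti : antisymmetric (fun x y : gen => (key x <= key y)%N).
Proof. by move=> x y; rewrite -eqn_leq => /eqP /key_inj. Qed.

Lemma sortw_perm (u v : word) : perm_eq u v -> sortw u = sortw v.
Proof. by move=> uv; apply/(perm_sortP key_total key_trans key_anti). Qed.

Lemma sortw_eq (u v : word) :
  sorted (fun x y : gen => (key x <= key y)%N) v -> perm_eq u v -> sortw u = v.
Proof.
move=> sv puv; apply: (sorted_eq key_trans key_anti) => //.
  exact: sort_sorted key_total _.
by rewrite perm_sort.
Qed.

Lemma pw_cat (u v : word) : pw (u ++ v) = pw u (+) pw v.
Proof. by rewrite /Defs.pw; elim: u => //= g u ->; rewrite addbA. Qed.

Section Swap.
Variable M : lmodType K.
Implicit Type phi : word -> M.

(* These are the maps that factor through the free supercommutative algebra. The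
   case g = h odd needs no separate axiom in characteristic zero. *)
Definition swapping phi := forall u g h v,
  phi (u ++ [:: g, h & v]) = (-1) ^+ (pg g && pg h) *: phi (u ++ [:: h, g & v]).

Lemma swapping_cons phi g : swapping phi -> swapping (fun w => phi (g :: w)).
Proof. by move=> sphi u x y v; exact: (sphi (g :: u)). Qed.

(** The exchange rule gives $\phi=-\phi$ on such a word, and 2 is invertible. *)
Lemma swapping_double phi u g v :
  swapping phi -> pg g -> phi (u ++ [:: g, g & v]) = 0.
Proof.
move=> sphi pgg; have := sphi u g g v; rewrite pgg expr1 scaleN1r => /eqP.
rewrite -addr_eq0 -mulr2n -scaler_nat scaler_eq0 pnatr_eq0 /=.
by move/eqP.
Qed.

Lemma swapping_move phi u g v1 v2 : swapping phi ->
  phi (u ++ g :: v1 ++ v2) =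
  (-1) ^+ (if pg g then count pg v1 else 0%N) *: phi (u ++ v1 ++ g :: v2).
Proof.
move=> sphi; elim: v1 u => [|h v1 IH] u /=; first by case: ifP; rewrite scale1r.
rewrite sphi -cat_rcons IH cat_rcons scalerA; congr (_ *: _).
by case: (pg g); rewrite /= ?mul1r // exprD.
Qed.

Lemma swapping_nuniq phi w :
  swapping phi -> ~~ uniq (filter pg w) -> phi w = 0.
Proof.
elim: w phi => //= g w IH phi sphi; case: ifP => /= pgg; last first.
  by move/(IH _ (swapping_cons g sphi)).
rewrite negb_and negbK mem_filter pgg /= => /orP[|]; last first.
  by move/(IH _ (swapping_cons g sphi)).
case/splitPr=> w1 w2.
rewrite (@swapping_move phi [::] g w1 (g :: w2) sphi) /=.
by rewrite swapping_double ?scaler0.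
Qed.

Lemma swapping_sort phi w :
  swapping phi -> phi w = (-1) ^+ oinv pB w *: phi (sortw w).
Proof.
elim: w phi => [|g w IH] phi sphi /=; first by rewrite expr0 scale1r.
rewrite (IH _ (swapping_cons g sphi)).
set z := sortw (g :: w).
have pz : perm_eq (g :: w) z by rewrite perm_sym /z /sortw perm_sort.
have gz : g \in z by rewrite -(perm_mem pz) mem_head.
have sz : sorted (fun x y : gen => (key x <= key y)%N) z.
  exact: sort_sorted key_total _.
have cz : count (fun h => pg h && (key h < key g)%N) w =
  count (fun h => pg h && (key h < key g)%N) z.
  by rewrite -(seq.permP pz) /= ltnn andbF.
(* The head is moved to its first occurrence in the sorted word: then the letters in front of it
   have strictly smaller keys, and the odd ones among them are exactly the inversions counted by
   [oinv]. *)
have : exists z1 z2, z = z1 ++ g :: z2 /\ g \notin z1.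
  exists (take (index g z) z), (drop (index g z).+1 z).
  rewrite in_take // ltnn; split=> //.
  by rewrite -{1}(cat_take_drop (index g z) z) (drop_nth g) ?index_mem // nth_index.
case=> z1 [z2 [zE gz1]].
have := sz; rewrite (sorted_pairwise key_trans) zE pairwise_cat /=.
case/and3P=> /allrelP ar pz1 /andP[ag pz2].
have -> : sortw w = z1 ++ z2.
  apply: sortw_eq.
    rewrite (sorted_pairwise key_trans) pairwise_cat pz1 pz2 !andbT.
    by apply/allrelP => x y xz yz; apply: ar; rewrite // inE yz orbT.
  by rewrite -(perm_cons g) (permPl pz) zE -(perm_catCA [:: g]) /= perm_refl.
rewrite (@swapping_move phi [::] g z1 z2 sphi) /= -zE scalerA -exprD addnC.
congr ((-1) ^+ (_ + _) *: _).
case: ifP => // pgg; rewrite cz zE count_cat /= ltnn andbF add0n.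
rewrite [X in (_ + X)%N](eq_in_count (a2 := pred0)) ?count_pred0 ?addn0.
  apply: eq_in_count => x xz.
  rewrite ltn_neqAle (ar x g xz) ?mem_head // andbT.
  case: eqP => [/key_inj xg|]; last by rewrite andbT.
  by rewrite -xg xz in gz1.
by move=> x xz /=; rewrite ltnNge (allP ag _ xz) andbF.
Qed.

(** Such a map is determined by its values on sorted words, with the very sign used in [coef]. This
    is why the exchange rule alone characterizes maps out of the free supercommutative algebra. *)
Lemma swapping_sgnw phi w : swapping phi -> phi w = sgnw w *: phi (sortw w).
Proof.
move=> sphi; rewrite /Defs.sgnw; case: ifP => [_|/negbT nu].
  exact: swapping_sort.
by rewrite scale0r swapping_nuniq.
Qed.

End Swap.

Lemma oinv_swap u g h v : (pg g && pg h -> g != h) ->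
  (-1) ^+ oinv pB (u ++ [:: g, h & v]) =
  (-1) ^+ (pg g && pg h) * (-1) ^+ oinv pB (u ++ [:: h, g & v]) :> K.
Proof.
move=> gh; elim: u => [|x u IH] /=; last first.
  rewrite !exprD IH mulrCA; congr (_ * (_ * _)); congr (_ ^+ _).
  case: ifP => // _; apply/seq.permP.
  by rewrite perm_cat2l -[_ :: _ :: v]cat1s -[h :: _]cat1s perm_catCA.
case: (boolP (pg g)) gh => pgg; case: (boolP (pg h)) => pgh gh /=; last first.
- by rewrite !add0n ?mul1r.
- by rewrite !add0n ?mul1r.
- by rewrite !add0n ?mul1r.
have {gh} : key g != key h by rewrite (inj_eq key_inj) gh.
case: ltngtP => // _ _; rewrite !exprD ?expr1 ?expr0 ?mul1r ?mulN1r ?mulNr ?mulrN ?opprK.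
  by rewrite mulrCA.
by rewrite mulrCA.
Qed.

Lemma sgnw_swap u g h v : 
  sgnw (u ++ [:: g, h & v]) = (-1) ^+ (pg g && pg h) * sgnw (u ++ [:: h, g & v]).
Proof.
have pe : perm_eq (u ++ [:: g, h & v]) (u ++ [:: h, g & v]).
  by rewrite perm_cat2l -[_ :: _ :: v]cat1s -[h :: _]cat1s perm_catCA.
rewrite /Defs.sgnw (perm_uniq (perm_filter _ pe)).
case: ifP => [un|]; last by rewrite mulr0.
apply: oinv_swap => /andP[pgg pgh]; apply: contraTN un => /eqP ->.
rewrite filter_cat /= pgh cat_uniq /= mem_head /=.
by rewrite !andbF.
Qed.

Definition coefw (m w : word) : K := if sortw w == m then sgnw w else 0.

(** Makes each coefficient itself an instance of [evalv], so that every [veq] reduces to an identity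
    between sums over terms. *)
Lemma swapping_coefw m : swapping (coefw m : word -> K^o).
Proof.
move=> u g h v; rewrite /coefw.
have pe : perm_eq (u ++ [:: g, h & v]) (u ++ [:: h, g & v]).
  by rewrite perm_cat2l -[_ :: _ :: v]cat1s -[h :: _]cat1s perm_catCA.
rewrite (sortw_perm pe); case: ifP => _; first exact: sgnw_swap.
by rewrite scaler0.
Qed.

Definition evalv (M : lmodType K) (phi : word -> M) (x : V K B) : M :=
  \sum_(t <- x) t.1 *: phi t.2.

Lemma coef_evalv x m : coef pB x m = evalv (coefw m : word -> K^o) x.
Proof.
rewrite /coef /evalv big_mkcond; apply: eq_bigr => t _.
rewrite /coefw; case: ifP => // _.
by rewrite scaler0.
Qed.

Lemma evalv_coef (M : lmodType K) (phi : word -> M) x (S : seq word) :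
  swapping phi -> uniq S -> {subset [seq sortw t.2 | t <- x] <= S} ->
  evalv phi x = \sum_(m <- S) coef pB x m *: phi m.
Proof.
move=> sphi uS sub; rewrite /evalv /coef.
under [RHS]eq_bigr do rewrite scaler_suml.
rewrite (exchange_big_dep xpredT) //=; apply: eq_big_seq => t tx.
rewrite -big_filter (@swapping_sgnw _ phi) // scalerA.
have -> : [seq m <- S | sortw t.2 == m] = [:: sortw t.2].
  rewrite -(filter_pred1_uniq uS (x := sortw t.2)); last exact/sub/map_f.
  by apply: eq_filter => m /=; rewrite eq_sym.
by rewrite big_seq1.
Qed.

(** Both sums are expanded over one common finite set of sorted words, where only the coefficients
    enter. This is the descent to the quotient. *)
Lemma evalv_veq (M : lmodType K) (phi : word -> M) x y :
  swapping phi -> veq pB x y -> evalv phi x = evalv phi y.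
Proof.
move=> sphi xy.
pose S := undup ([seq sortw t.2 | t <- x] ++ [seq sortw t.2 | t <- y]).
rewrite !(@evalv_coef _ _ _ S) ?undup_uniq //; first by apply: eq_bigr => m _; rewrite xy.
  by move=> m my; rewrite mem_undup mem_cat my orbT.
by move=> m my; rewrite mem_undup mem_cat my.
Qed.

Lemma evalv_cat (M : lmodType K) (phi : word -> M) x y :
  evalv phi (x ++ y) = evalv phi x + evalv phi y.
Proof. exact: big_cat. Qed.

Lemma evalv_scale (M : lmodType K) (phi : word -> M) c x :
  evalv phi (vscale c x) = c *: evalv phi x.
Proof.
by rewrite /evalv big_map scaler_sumr; apply: eq_bigr => t _; rewrite scalerA.
Qed.

Lemma evalv_flatten (M : lmodType K) (phi : word -> M) (I : Type) (F : I -> V K B) l :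
  evalv phi (flatten [seq F i | i <- l]) = \sum_(i <- l) evalv phi (F i).
Proof.
elim: l => [|i l IH] /=; first by rewrite /evalv !big_nil.
by rewrite big_cons -IH evalv_cat.
Qed.

Lemma evalv_mul (M : lmodType K) (phi : word -> M) x y :
  evalv phi (vmul x y) =
  \sum_(s <- x) s.1 *: \sum_(t <- y) t.1 *: phi (s.2 ++ t.2).
Proof.
rewrite /evalv /vmul big_allpairs_dep; apply: eq_bigr => s _.
by rewrite scaler_sumr; apply: eq_bigr => t _; rewrite scalerA.
Qed.

(** Decidable form of [veq], as the quotient construction requires: a coefficient can be nonzero
    only at the sorted form of a word that occurs. *)
Definition veqb (x y : V K B) : bool :=
  all (fun m => coef pB x m == coef pB y m)
    ([seq sortw t.2 | t <- x] ++ [seq sortw t.2 | t <- y]).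

Lemma veqP x y : reflect (veq pB x y) (veqb x y).
Proof.
apply: (iffP allP) => [H m|H m _]; last exact/eqP.
have [min|mnin] := boolP (m \in
  ([seq sortw t.2 | t <- x] ++ [seq sortw t.2 | t <- y])).
  exact/eqP/H.
have aux z : m \notin [seq sortw t.2 | t <- z] -> coef pB z m = 0.
  move=> mz; rewrite /coef big_seq_cond big1 // => t /andP[tz /eqP E].
  by case/negP: mz; rewrite -E; exact: (map_f (fun t => sortw t.2) tz).
by move: mnin; rewrite mem_cat negb_or => /andP[/aux -> /aux ->].
Qed.

Lemma veqb_equiv : equiv_class_of veqb.
Proof.
split=> [x|x y|y x z].
- exact/veqP.
- by apply/veqP/veqP=> H m; rewrite H.
- by move=> /veqP xy /veqP yz; apply/veqP => m; rewrite xy yz.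
Qed.

Canonical veqb_equiv_rel := EquivRelPack veqb_equiv.

End Words.

(** * The algebra structure on the quotient *)

Section SuperRing.
Variables (K : numFieldType) (B : finType) (pB : B -> bool).
Notation word := (word B).

Lemma veq_cat x x' y y' :
  veq pB x x' -> veq pB y y' -> veq pB (x ++ y : V K B) (x' ++ y').
Proof. by move=> xx yy m; rewrite !coef_evalv !evalv_cat -!coef_evalv xx yy. Qed.

Lemma veq_scale c x x' : veq pB x x' -> veq pB (vscale c x : V K B) (vscale c x').
Proof. by move=> xx m; rewrite !coef_evalv !evalv_scale -!coef_evalv xx. Qed.

Lemma swapping_catl (M : lmodType K) (phi : word -> M) v :
  swapping pB phi -> swapping pB (fun w => phi (w ++ v)).
Proof. by move=> sphi u g h v'; rewrite -!catA; exact: sphi. Qed.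

Lemma swapping_catr (M : lmodType K) (phi : word -> M) v :
  swapping pB phi -> swapping pB (fun w => phi (v ++ w)).
Proof. by move=> sphi u g h v'; rewrite !catA; exact: sphi. Qed.

Lemma swapping_sum (M : lmodType K) I (r : seq I) (c : I -> K) (phi : I -> word -> M) :
  (forall i, swapping pB (phi i)) -> swapping pB (fun w => \sum_(i <- r) c i *: phi i w).
Proof.
move=> sphi u g h v; rewrite scaler_sumr; apply: eq_bigr => i _.
by rewrite sphi !scalerA mulrC.
Qed.

Lemma veq_mul x x' y y' :
  veq pB x x' -> veq pB y y' -> veq pB (vmul x y : V K B) (vmul x' y').
Proof.
move=> xx yy m; rewrite !coef_evalv !evalv_mul.
have sc := @swapping_coefw K B pB m.
transitivity (\sum_(s <- x) s.1 *: \sum_(t <- y') t.1 *: (coefw K pB m (s.2 ++ t.2) : K^o)).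
  apply: eq_bigr => s _; apply: (congr1 (fun z : K^o => s.1 *: z)).
  exact: (@evalv_veq _ _ _ _ (fun w => coefw K pB m (s.2 ++ w) : K^o) _ _ (swapping_catr _ sc) yy).
apply: (@evalv_veq _ _ _ _ (fun w => \sum_(t <- y') t.1 *: (coefw K pB m (w ++ t.2) : K^o)) _ _ _ xx).
by apply: swapping_sum => t; exact: (swapping_catl _ sc).
Qed.

Definition spoly := {eq_quot (@veqb_equiv_rel K B pB)}.
HB.instance Definition _ := Choice.on spoly.
HB.instance Definition _ := EqQuotient.on spoly.

Definition cls (x : V K B) : spoly := \pi_spoly x.

Lemma clsP x y : cls x = cls y <-> veq pB x y.
Proof.
split=> [/eqP|xy].
  by rewrite /cls eqmodE => /veqP.
by apply/eqP; rewrite /cls eqmodE; apply/veqP.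
Qed.

Lemma veq_repr x : veq pB (generic_quotient.repr (cls x)) x.
Proof. by apply/clsP; rewrite /cls reprK. Qed.

Lemma clsW (P : spoly -> Prop) : (forall x, P (cls x)) -> forall x, P x.
Proof. by move=> H x; rewrite -[x]reprK; exact: H. Qed.

Definition sp_add (x y : spoly) := cls (generic_quotient.repr x ++ generic_quotient.repr y).
Definition sp_opp (x : spoly) := cls (vscale (-1) (generic_quotient.repr x)).
Definition sp_scale c (x : spoly) := cls (vscale c (generic_quotient.repr x)).
Definition sp_mul (x y : spoly) := cls (vmul (generic_quotient.repr x) (generic_quotient.repr y)).

Lemma sp_addE x y : sp_add (cls x) (cls y) = cls (x ++ y).
Proof. by apply/clsP/veq_cat; exact: veq_repr. Qed.
Lemma sp_scaleE c x : sp_scale c (cls x) = cls (vscale c x).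
Proof. by apply/clsP/veq_scale; exact: veq_repr. Qed.
Lemma sp_mulE x y : sp_mul (cls x) (cls y) = cls (vmul x y).
Proof. by apply/clsP/veq_mul; exact: veq_repr. Qed.
Lemma sp_oppE x : sp_opp (cls x) = cls (vscale (-1) x).
Proof. exact: sp_scaleE. Qed.

Lemma sp_addA : associative sp_add.
Proof.
elim/clsW=> x; elim/clsW=> y; elim/clsW=> z.
by rewrite !sp_addE catA.
Qed.
Lemma sp_addC : commutative sp_add.
Proof.
elim/clsW=> x; elim/clsW=> y; rewrite !sp_addE; apply/clsP => m.
by rewrite !coef_evalv !evalv_cat addrC.
Qed.
Lemma sp_add0 : left_id (cls [::]) sp_add.
Proof. by elim/clsW=> x; rewrite sp_addE. Qed.
Lemma sp_addN : left_inverse (cls [::]) sp_opp sp_add.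
Proof.
elim/clsW=> x; rewrite sp_oppE sp_addE; apply/clsP => m.
by rewrite !coef_evalv evalv_cat evalv_scale scaleN1r addNr /evalv big_nil.
Qed.

HB.instance Definition _ := GRing.isZmodule.Build spoly sp_addA sp_addC sp_add0 sp_addN.

Lemma clsD x y : cls (x ++ y) = cls x + cls y.
Proof. by rewrite -sp_addE. Qed.

Lemma sp_scaleA a b x : sp_scale a (sp_scale b x) = sp_scale (a * b) x.
Proof.
elim/clsW: x => x; rewrite !sp_scaleE; apply/clsP => m.
by rewrite !coef_evalv !evalv_scale scalerA.
Qed.
Lemma sp_scale1 : left_id 1 sp_scale.
Proof.
elim/clsW => x; rewrite !sp_scaleE; apply/clsP => m.
by rewrite !coef_evalv !evalv_scale scale1r.
Qed.
Lemma sp_scaleDr : right_distributive sp_scale +%R.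
Proof.
move=> c; elim/clsW => x; elim/clsW => y.
rewrite -clsD !sp_scaleE -clsD; apply/clsP => m.
by rewrite !coef_evalv evalv_cat !evalv_scale evalv_cat scalerDr.
Qed.
Lemma sp_scaleDl v : {morph sp_scale^~ v: a b / a + b}.
Proof.
elim/clsW: v => x a b; rewrite !sp_scaleE -clsD; apply/clsP => m.
by rewrite !coef_evalv evalv_cat !evalv_scale scalerDl.
Qed.

HB.instance Definition _ :=
  GRing.Zmodule_isLmodule.Build K spoly sp_scaleA sp_scale1 sp_scaleDr sp_scaleDl.

Lemma clsZ c x : cls (vscale c x) = c *: cls x.
Proof. by rewrite -sp_scaleE. Qed.

Lemma sp_mulA : associative sp_mul.
Proof.
elim/clsW=> x; elim/clsW=> y; elim/clsW=> z; rewrite !sp_mulE; apply/clsP => m.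
rewrite !coef_evalv !evalv_mul /vmul big_allpairs_dep; apply: eq_bigr => s _ /=.
rewrite big_allpairs_dep scaler_sumr; apply: eq_bigr => t _ /=.
rewrite scaler_sumr [RHS]scaler_sumr; apply: eq_bigr => u _ /=.
by rewrite !scalerA mulrA catA.
Qed.
Lemma sp_mul1 : left_id (cls (vone K B)) sp_mul.
Proof.
elim/clsW => x; rewrite sp_mulE; apply/clsP => m.
rewrite !coef_evalv evalv_mul /vone big_seq1 scale1r.
by [].
Qed.
Lemma sp_mulr1 : right_id (cls (vone K B)) sp_mul.
Proof.
elim/clsW => x; rewrite sp_mulE; apply/clsP => m.
rewrite !coef_evalv evalv_mul; apply: eq_bigr => s _.
by rewrite /vone big_seq1 scale1r cats0.
Qed.
Lemma sp_mulDl : left_distributive sp_mul +%R.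
Proof.
elim/clsW=> x; elim/clsW=> y; elim/clsW=> z.
rewrite -clsD !sp_mulE -clsD; apply/clsP => m.
by rewrite !coef_evalv evalv_cat !evalv_mul big_cat.
Qed.
Lemma sp_mulDr : right_distributive sp_mul +%R.
Proof.
elim/clsW=> x; elim/clsW=> y; elim/clsW=> z.
rewrite -clsD !sp_mulE -clsD; apply/clsP => m.
rewrite !coef_evalv evalv_cat !evalv_mul -big_split.
by apply: eq_bigr => s _; rewrite big_cat scalerDr.
Qed.
Lemma sp_one_neq0 : cls (vone K B) != 0.
Proof.
apply/eqP => /clsP /(_ [::]).
rewrite !coef_evalv /evalv /vone big_seq1 big_nil /coefw /= /sortw /= /sgnw /=.
by rewrite scale1r expr0 => /eqP; rewrite oner_eq0.
Qed.

HB.instance Definition _ := GRing.Zmodule_isNzRing.Build spoly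
  sp_mulA sp_mul1 sp_mulr1 sp_mulDl sp_mulDr sp_one_neq0.

Lemma clsM x y : cls (vmul x y) = cls x * cls y.
Proof. by rewrite -sp_mulE. Qed.

Lemma sp_scaleAl (a : K) (u v : spoly) : a *: (u * v) = (a *: u) * v.
Proof.
elim/clsW: u => x; elim/clsW: v => y; rewrite -(clsZ a x) -!clsM -clsZ.
apply/clsP => m; rewrite !coef_evalv evalv_scale !evalv_mul big_map scaler_sumr.
by apply: eq_bigr => s _; rewrite scalerA.
Qed.

HB.instance Definition _ := GRing.Lmodule_isLalgebra.Build K spoly sp_scaleAl.

Lemma sp_scaleAr (a : K) (u v : spoly) : a *: (u * v) = u * (a *: v).
Proof.
elim/clsW: u => x; elim/clsW: v => y; rewrite -(clsZ a y) -!clsM -clsZ.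
apply/clsP => m; rewrite !coef_evalv evalv_scale !evalv_mul scaler_sumr.
apply: eq_bigr => s _; rewrite big_map scalerA mulrC -scalerA scaler_sumr.
apply: (congr1 (fun z : K^o => s.1 *: z)).
by apply: eq_bigr => t _; rewrite scalerA.
Qed.

HB.instance Definition _ := GRing.Lalgebra_isAlgebra.Build K spoly sp_scaleAr.

Definition mon (w : word) : spoly := cls [:: (1, w)].

Lemma mon_cat u v : mon (u ++ v) = mon u * mon v.
Proof. by rewrite -clsM /vmul /= mulr1. Qed.
Lemma mon_cons g v : mon (g :: v) = mon [:: g] * mon v.
Proof. exact: (mon_cat [:: g] v). Qed.
Lemma mon0 : mon [::] = 1. Proof. by []. Qed.

Lemma clsE x : cls x = evalv mon x.
Proof.
rewrite /evalv; elim: x => [|[c w] x IH]; first by rewrite big_nil.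
rewrite big_cons -{}IH /= /mon -clsZ -clsD.
by rewrite /vscale /= mulr1.
Qed.

Lemma swapping_mon : swapping pB mon.
Proof.
move=> u g h v; rewrite /mon -clsZ; apply/clsP => m.
rewrite !coef_evalv evalv_scale /evalv !big_seq1 /=.
by rewrite (@swapping_coefw K B pB m u g h v) !scalerA !mul1r mulr1.
Qed.

Lemma spW (P : spoly -> Prop) :
  P 0 -> (forall c w x, P x -> P (c *: mon w + x)) -> forall x, P x.
Proof.
move=> P0 PS; elim/clsW=> x; rewrite clsE /evalv.
by elim: x => [|[c w] x IH]; rewrite ?big_nil // big_cons; exact: PS.
Qed.

(** Computed on a chosen representative, hence defined for every [phi]; it is linear and has the
    expected values once [phi] satisfies the exchange rule. *)
Definition lin (M : lmodType K) (phi : word -> M) (x : spoly) : M := evalv phi (generic_quotient.repr x).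

Lemma linE (M : lmodType K) (phi : word -> M) x :
  swapping pB phi -> lin phi (cls x) = evalv phi x.
Proof. by move=> sphi; apply: evalv_veq sphi _; exact: veq_repr. Qed.

Lemma lin_mon (M : lmodType K) (phi : word -> M) w :
  swapping pB phi -> lin phi (mon w) = phi w.
Proof. by move=> sphi; rewrite linE // /evalv big_seq1 scale1r. Qed.

Lemma lin_linear (M : lmodType K) (phi : word -> M) :
  swapping pB phi -> linear (lin phi).
Proof.
move=> sphi c; elim/clsW=> x; elim/clsW=> y.
by rewrite -clsZ -clsD !linE // evalv_cat evalv_scale.
Qed.

End SuperRing.

(** * Parity, homomorphisms and superderivations *)

Section Superalgebra.
Variables (K : numFieldType) (B : finType) (pB : B -> bool).
Notation gen := (gen B).
Notation word := (word B).
Notation pg := (pg pB).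
Notation pw := (pw pB).
Notation R := (spoly K pB).
Notation mon := (@mon K B pB).

Lemma swapping_par : swapping pB (fun w => (-1) ^+ pw w *: mon w).
Proof.
move=> u g h v; rewrite swapping_mon !scalerA mulrC; congr (_ * _ *: _).
by rewrite !pw_cat /Defs.pw /= (addbCA (pg g)).
Qed.

(** The parity automorphism. With it the signs of super Leibniz rules make sense for arbitrary
    elements, without splitting them into homogeneous parts. *)
Definition spar : R -> R := lin (fun w => (-1) ^+ pw w *: mon w).

HB.instance Definition _ :=
  GRing.isLinear.Build K R R _ spar (lin_linear swapping_par).

Lemma sparD : {morph spar : x y / x + y}. Proof. exact: linearD. Qed.
Lemma sparZ c x : spar (c *: x) = c *: spar x. Proof. exact: linearZ. Qed.

Lemma spar_mon w : spar (mon w) = (-1) ^+ pw w *: mon w.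
Proof. exact: lin_mon swapping_par. Qed.

Lemma sparM x y : spar (x * y) = spar x * spar y.
Proof.
elim/(@spW K B pB): x => [|c u x IHx]; first by rewrite !mul0r raddf0 mul0r.
rewrite mulrDl !sparD mulrDl IHx; congr (_ + _) => {x IHx}.
elim/(@spW K B pB): y => [|d v y IHy]; first by rewrite mulr0 raddf0 mulr0.
rewrite mulrDr !sparD mulrDr IHy; congr (_ + _) => {y IHy}.
rewrite -scalerAl -scalerAr -mon_cat !sparZ !spar_mon -scalerAl -scalerAr.
rewrite -scalerAl -scalerAr -mon_cat !scalerA pw_cat signr_addb.
by rewrite !mulrA.
Qed.

Lemma spar1 : spar 1 = 1.
Proof. by rewrite -mon0 spar_mon /= scale1r. Qed.

Lemma sparK : involutive spar.
Proof.
elim/(@spW K B pB) => [|c u x IHx]; first by rewrite !raddf0.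
rewrite !sparD IHx; congr (_ + _).
by rewrite !sparZ !spar_mon sparZ spar_mon !scalerA -mulrA -signr_addb addbb mulr1.
Qed.

Definition spow (b : bool) (x : R) : R := if b then spar x else x.

HB.instance Definition _ b := GRing.isLinear.Build K R R _ (spow b)
  (fun c x y => match b return spow b (c *: x + y) = c *: spow b x + spow b y
     with true => linearP spar c x y | false => erefl end).

Lemma spowD b : {morph spow b : x y / x + y}. Proof. exact: linearD. Qed.
Lemma spowZ b c x : spow b (c *: x) = c *: spow b x. Proof. exact: linearZ. Qed.

Lemma spowM b x y : spow b (x * y) = spow b x * spow b y.
Proof. by case: b => //=; exact: sparM. Qed.

Lemma spow1 b : spow b 1 = 1.
Proof. by case: b => //=; exact: spar1. Qed.

Lemma spow_mon b w : spow b (mon w) = (-1) ^+ (b && pw w) *: mon w.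
Proof. by case: b => /=; rewrite ?spar_mon // scale1r. Qed.

Definition homog (b : bool) (x : R) := spar x = (-1) ^+ b *: x.

Lemma homog_spow b c x : homog c x -> spow b x = (-1) ^+ (b && c) *: x.
Proof. by move=> hx; case: b => /=; rewrite ?hx // scale1r. Qed.

Lemma homog_mon w : homog (pw w) (mon w).
Proof. exact: spar_mon. Qed.

Lemma homog_gen g : homog (pg g) (mon [:: g]).
Proof. by rewrite -[pg g]addbF; exact: homog_mon. Qed.

Lemma homog0 b : homog b 0.
Proof. by rewrite /homog raddf0 scaler0. Qed.

Lemma homog1 : homog false 1.
Proof. by rewrite /homog spar1 scale1r. Qed.

Lemma homogD b x y : homog b x -> homog b y -> homog b (x + y).
Proof. by move=> hx hy; rewrite /homog sparD hx hy scalerDr. Qed.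

Lemma homogZ b c x : homog b x -> homog b (c *: x).
Proof. by move=> hx; rewrite /homog sparZ hx !scalerA mulrC. Qed.

Lemma homogN b x : homog b x -> homog b (- x).
Proof. by rewrite -scaleN1r; exact: homogZ. Qed.

Lemma homogM b c x y : homog b x -> homog c y -> homog (b (+) c) (x * y).
Proof.
by move=> hx hy; rewrite /homog sparM hx hy -scalerAl -scalerAr scalerA signr_addb.
Qed.

Lemma homog_sum b I (r : seq I) (P : pred I) (F : I -> R) :
  (forall i, P i -> homog b (F i)) -> homog b (\sum_(i <- r | P i) F i).
Proof.
move=> hF; elim/big_ind: _ => //; [exact: homog0|exact: homogD].
Qed.

Lemma mul_mon x v : x * mon v = mon v * spow (pw v) x.
Proof.
elim/(@spW K B pB): x => [|c u x IHx]; first by rewrite raddf0 mulr0 mul0r.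
rewrite spowD mulrDl mulrDr IHx; congr (_ + _).
rewrite spowZ spow_mon -scalerAl -!scalerAr; congr (_ *: _).
rewrite -!mon_cat {IHx}; elim: v => [|h v IH]; first by rewrite cats0 scale1r.
have -> : mon (u ++ h :: v) = (-1) ^+ (pg h && pw u) *: mon (h :: u ++ v).
  rewrite {IH}; elim: u => [|g u IH] /=; first by rewrite andbF scale1r.
  rewrite mon_cons IH -scalerAr -mon_cons.
  rewrite (@swapping_mon K B pB [::] g h) /= scalerA -signr_addb.
  by congr ((-1) ^+ nat_of_bool _ *: _); rewrite /Defs.pw /= -/(Defs.pw pB u); case: (pg g) (pg h) (Defs.pw _ _) => -[] [].
rewrite mon_cons IH -scalerAr -mon_cons scalerA -signr_addb.
by congr ((-1) ^+ nat_of_bool _ *: _); rewrite /Defs.pw /= andb_addl.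
Qed.

Lemma homog_mulC b x y : homog b x -> x * y = spow b y * x.
Proof.
move=> hx; elim/(@spW K B pB): y => [|c u y IH]; first by rewrite raddf0 mulr0 mul0r.
rewrite spowD mulrDl mulrDr IH; congr (_ + _).
rewrite spowZ -scalerAl -scalerAr mul_mon spow_mon (homog_spow _ hx).
by rewrite -scalerAr -scalerAl andbC.
Qed.

Lemma homog_supercomm b c x y : homog b x -> homog c y ->
  x * y = (-1) ^+ (b && c) *: (y * x).
Proof. by move=> hx hy; rewrite (homog_mulC _ hx) (homog_spow _ hy) scalerAl. Qed.

Section Hom.
Variable eta : gen -> R.

Definition homw (w : word) : R := foldr *%R 1 [seq eta g | g <- w].

Hypothesis eta_homog : forall g, homog (pg g) (eta g).

Lemma homw_cat u v : homw (u ++ v) = homw u * homw v.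
Proof.
by rewrite /homw; elim: u => [|g u IH] /=; rewrite ?mul1r // IH mulrA.
Qed.

Lemma swapping_homw : swapping pB homw.
Proof.
move=> u g h v; rewrite !homw_cat scalerAr; congr (_ * _).
rewrite /homw /= !mulrA (homog_supercomm (eta_homog g) (eta_homog h)).
by rewrite -scalerAl.
Qed.

Lemma homw_homog w : homog (pw w) (homw w).
Proof.
rewrite /homw /Defs.pw; elim: w => [|g w IH] /=; first exact: homog1.
exact: homogM.
Qed.

Definition shom : R -> R := lin homw.

Lemma shom_linear : linear shom.
Proof. exact: lin_linear swapping_homw. Qed.

Lemma shom_mon w : shom (mon w) = homw w.
Proof. exact: lin_mon swapping_homw. Qed.

Lemma shomM x y : shom (x * y) = shom x * shom y.
Proof.
have hD u v : shom (u + v) = shom u + shom v.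
  by rewrite -[u]scale1r shom_linear !scale1r.
have h0 : shom 0 = 0 by apply: (addrI (shom 0)); rewrite -hD !addr0.
elim/(@spW K B pB): x => [|c u x IHx]; first by rewrite !mul0r h0 mul0r.
rewrite mulrDl -scalerAl !shom_linear IHx mulrDl -scalerAl; congr (_ *: _ + _).
elim/(@spW K B pB): y {x IHx} => [|d v y IHy]; first by rewrite !mulr0 h0 mulr0.
rewrite mulrDr -scalerAr !shom_linear IHy mulrDr -scalerAr; congr (_ *: _ + _).
by rewrite -mon_cat !shom_mon homw_cat.
Qed.

End Hom.

Section Derivation.
Variables (e : bool) (delta : gen -> R).

Fixpoint derw (w : word) : R :=
  if w is g :: w' then
    delta g * mon w' + (-1) ^+ (e && pg g) *: (mon [:: g] * derw w')
  else 0.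

Hypothesis delta_homog : forall g, homog (e (+) pg g) (delta g).

Lemma derw_homog w : homog (e (+) pw w) (derw w).
Proof.
elim: w => [|g w IH]; first exact: homog0.
apply: homogD.
  by rewrite /Defs.pw /= addbA; apply: homogM => //; exact: homog_mon.
apply: homogZ; rewrite /Defs.pw /= addbCA.
by apply: homogM => //; exact: homog_gen.
Qed.

(** Existence of a superderivation with prescribed values on generators. The parity condition on
    [delta] lets [delta g] supercommute with the neighbouring letter, with just the sign the
    exchange rule asks for. *)
Lemma swapping_derw : swapping pB derw.
Proof.
move=> u g h v; elim: u => [|x u IH] /=; last first.
  rewrite IH swapping_mon -!scalerAr scalerDr !scalerA; congr (_ + _ *: _).
  exact: mulrC.
rewrite !mulrDr !scalerDr -!scalerAr !scalerA.
rewrite [mon (h :: v)]mon_cons [mon (g :: v)]mon_cons !mulrA.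
rewrite (homog_supercomm (delta_homog g) (homog_gen h)).
rewrite (homog_supercomm (delta_homog h) (homog_gen g)).
rewrite (homog_supercomm (homog_gen g) (homog_gen h)).
rewrite -!scalerAl !scalerA addrCA -!signr_addb; congr (_ *: _ + (_ *: _ + _ *: _));
  by congr ((-1) ^+ nat_of_bool _); case: e (pg g) (pg h) => -[] [].
Qed.

Definition der : R -> R := lin derw.

Lemma der_linear : linear der.
Proof. exact: lin_linear swapping_derw. Qed.

Lemma derD : {morph der : x y / x + y}.
Proof. by move=> x y; rewrite -[x]scale1r der_linear !scale1r. Qed.

Lemma der0 : der 0 = 0.
Proof. by apply: (addrI (der 0)); rewrite -derD !addr0. Qed.

Lemma derZ c x : der (c *: x) = c *: der x.
Proof. by rewrite -[c *: x]addr0 der_linear der0 addr0. Qed.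

Lemma der_mon w : der (mon w) = derw w.
Proof. exact: lin_mon swapping_derw. Qed.

Lemma der_gen g : der (mon [:: g]) = delta g.
Proof. by rewrite der_mon /= mulr1 mulr0 scaler0 addr0. Qed.

Lemma der1 : der 1 = 0.
Proof. by rewrite -mon0 der_mon. Qed.

Lemma derM x y : der (x * y) = der x * y + spow e x * der y.
Proof.
elim/(@spW K B pB): x => [|c u x IHx]; first by rewrite mul0r der0 raddf0 !mul0r addr0.
rewrite mulrDl !derD IHx spowD !mulrDl addrACA; congr (_ + _) => {x IHx}.
rewrite -scalerAl !derZ -!scalerAl spowZ -scalerAl -scalerDr; congr (_ *: _).
elim: u => [|g u IH]; first by rewrite mon0 der1 spow1 mul0r !mul1r add0r.
rewrite [mon (g :: u)]mon_cons -mulrA.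
have aux z : der (mon [:: g] * z) = delta g * z + spow e (mon [:: g]) * der z.
  elim/(@spW K B pB): z => [|d v z IHz]; first by rewrite mulr0 der0 !mulr0 addr0.
  rewrite mulrDr !derD IHz !mulrDr addrACA; congr (_ + _).
  rewrite -scalerAr !derZ -!scalerAr -scalerDr; congr (_ *: _).
  by rewrite -mon_cons !der_mon /= (homog_spow _ (homog_gen g)) scalerAl.
by rewrite !aux IH spowM mulrDr mulrDl !mulrA addrA.
Qed.

Lemma spar_der x : spar (der x) = (-1) ^+ e *: der (spar x).
Proof.
elim/(@spW K B pB): x => [|c u x IHx].
  by rewrite !raddf0 der0 raddf0 scaler0.
rewrite sparD !derD !sparD IHx scalerDr; congr (_ + _).
rewrite sparZ !derZ sparZ spar_mon der_mon derZ der_mon derw_homog.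
by rewrite signr_addb !scalerA mulrCA mulrA.
Qed.

End Derivation.

Lemma D_delta_homog g : homog (true (+) pg g) (mon [:: Dg g]).
Proof.
have -> : true (+) pg g = pg (Dg g); last exact: homog_gen.
by rewrite /Defs.pg /=; case: (pB _) (odd _) => -[].
Qed.

Definition D : R -> R := der true (fun g => mon [:: Dg g]).

Lemma DD : {morph D : x y / x + y}. Proof. exact: derD D_delta_homog. Qed.
Lemma D0 : D 0 = 0. Proof. exact: der0 D_delta_homog. Qed.
Lemma D1 : D 1 = 0. Proof. exact: der1 D_delta_homog. Qed.
Lemma DZ c x : D (c *: x) = c *: D x. Proof. exact: derZ D_delta_homog _ _. Qed.
Lemma D_gen g : D (mon [:: g]) = mon [:: Dg g].
Proof. exact: der_gen D_delta_homog _. Qed.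
Lemma DM x y : D (x * y) = D x * y + spar x * D y.
Proof. exact: derM D_delta_homog _ _. Qed.
Lemma spar_D x : spar (D x) = - D (spar x).
Proof. by rewrite (spar_der D_delta_homog) expr1 scaleN1r. Qed.
Lemma D_homog b x : homog b x -> homog (~~ b) (D x).
Proof. by move=> hx; rewrite /homog spar_D hx DZ signrN scaleNr. Qed.

HB.instance Definition _ := GRing.isLinear.Build K R R _ D (der_linear D_delta_homog).

Lemma cls_flatten I (r : seq I) (F : I -> V K B) :
  cls pB (flatten [seq F i | i <- r]) = \sum_(i <- r) cls pB (F i).
Proof. by rewrite clsE evalv_flatten; apply: eq_bigr => i _; rewrite clsE. Qed.

Lemma cls_scaled_map c u (x : V K B) (f : word -> word) :
  cls pB [seq (c * t.1, u ++ f t.2) | t <- x] =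
  c *: (mon u * cls pB [seq (t.1, f t.2) | t <- x]).
Proof.
rewrite !clsE /evalv !big_map mulr_sumr scaler_sumr; apply: eq_bigr => t _ /=.
by rewrite mon_cat -scalerAr scalerA.
Qed.

Lemma cls_Dword w : cls pB (Dword K pB w) = D (mon w).
Proof.
rewrite /D der_mon; last exact: D_delta_homog.
elim: w => [|g w IH] //=; rewrite -IH.
rewrite -cat1s clsD -mon_cons; congr (_ + _).
rewrite (cls_scaled_map _ [:: g] _ id); congr (_ *: (_ * cls pB _)).
by elim: (Dword _ _ _) => //= -[c u] x ->.
Qed.

Lemma cls_Dv x : cls pB (Dv pB x) = D (cls pB x).
Proof.
rewrite cls_flatten [in RHS]clsE raddf_sum; apply: eq_bigr => t _ /=.
by rewrite clsZ cls_Dword DZ.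
Qed.

End Superalgebra.

(** * Coefficients of the SUSY bracket *)

Section Bracket.
Variables (K : numFieldType) (B : finType) (pB : B -> bool).
Notation gen := (gen B).
Notation pg := (pg pB).
Notation R := (spoly K pB).
Notation mon := (@mon K B pB).
Notation D := (@D K B pB).
Notation spow := (@spow K B pB).

(** Left multiplication by $\chi$, seen on the sequence of coefficients. *)
Definition prevc (f : nat -> R) (j : nat) : R := if j is j'.+1 then f j' else 0.

Definition chicls (X : CV K B) (j : nat) : R := cls pB (chicoef X j).

Lemma chicls_nil j : chicls [::] j = 0.
Proof. by []. Qed.

Lemma chicls_cat X Y j : chicls (X ++ Y) j = chicls X j + chicls Y j.
Proof. by rewrite /chicls /chicoef filter_cat map_cat clsD. Qed.

Lemma chicls_seq1 i c w j : chicls [:: (i, (c, w))] j = if i == j then c *: mon w else 0.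
Proof.
rewrite /chicls /chicoef /=; case: ifP => _ //=.
by rewrite clsE /evalv big_seq1.
Qed.

Lemma chicls_cons i c w X j :
  chicls ((i, (c, w)) :: X) j = (if i == j then c *: mon w else 0) + chicls X j.
Proof. by rewrite -cat1s chicls_cat chicls_seq1. Qed.

Lemma chicls_flatten I (r : seq I) (F : I -> CV K B) j :
  chicls (flatten [seq F i | i <- r]) j = \sum_(i <- r) chicls (F i) j.
Proof.
elim: r => [|i r IH] /=; first by rewrite big_nil.
by rewrite chicls_cat IH big_cons.
Qed.

Lemma chicls_scale c X j : chicls (cscale c X) j = c *: chicls X j.
Proof.
elim: X => [|[i [d w]] X IH]; first by rewrite chicls_nil scaler0.
rewrite /= !chicls_cons IH scalerDr; congr (_ + _).
by case: eqP; rewrite ?scaler0 // scalerA.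
Qed.

Lemma chicls_chimul X j : chicls (chimul X) j = prevc (chicls X) j.
Proof.
elim: X => [|[i [d w]] X IH]; first by case: j.
rewrite /= !chicls_cons IH; case: j {IH} => [|j] /=; first by rewrite addr0.
by rewrite chicls_cons.
Qed.

Lemma chicls_const i x j :
  chicls [seq (i, u) | u <- x] j = if i == j then cls pB x else 0.
Proof.
elim: x => [|[c w] x IH] /=; first by case: ifP.
rewrite chicls_cons IH; case: ifP => _; last by rewrite addr0.
by rewrite [RHS]clsE /evalv big_cons -/(evalv _ _) -clsE.
Qed.

Lemma chicls_chiD X j : chicls (chiD pB X) j =
  (-1) ^+ odd j *: D (chicls X j)
  + prevc (fun j' => (if odd j' then -2 else 0) *: chicls X j') j.
Proof.
elim: X => [|[i [d w]] X IH].
  by rewrite /= !chicls_nil D0 scaler0; case: j => [|j] /=; rewrite ?chicls_nil ?scaler0 addr0.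
rewrite [chiD _ _]/= chicls_cat {}IH !chicls_cons DD scalerDr.
rewrite chicls_cat chicls_const clsZ cls_Dword chicls_seq1.
case: j => [|j] /=.
  rewrite !addr0; congr (_ + _); case: eqP => [->|_]; last by rewrite D0 scaler0.
  by rewrite !scale1r expr0 mul1r DZ.
rewrite chicls_cons scalerDr [in RHS]addrACA; congr (_ + _).
rewrite eqSS; congr (_ + _).
  by case: eqP => [->|_]; rewrite ?D0 ?scaler0 // DZ scalerA.
by case: eqP => [->|_]; rewrite ?scaler0 // scalerA.
Qed.

Variables (lb : B -> B -> seq (K * B)) (fm : B -> B -> K).
Hypothesis lb_par : forall a b t, t \in lb a b -> t.1 != 0 -> pB t.2 = pB a (+) pB b.
Hypothesis fm_par : forall a b, fm a b != 0 -> pB a = pB b.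

Definition bdelta (a : B) (j : nat) (g : gen) : R := chicls (brGen pB lb fm a g) j.

Lemma bdelta0 a j b : bdelta a j (b, 0%N) =
  match j with
  | 0 => (-1) ^+ (pB a && ~~ pB b) *: \sum_(t <- lb a b) t.1 *: mon [:: (t.2, 0%N)]
  | 1 => fm a b *: 1
  | _ => 0
  end.
Proof.
rewrite /bdelta /brGen /= /base chicls_cat chicls_seq1.
have -> : chicls [seq (0%N, ((-1) ^+ (pB a && ~~ pB b) * t.1, [:: (t.2, 0%N)])) | t <- lb a b] j
  = if j == 0%N then (-1) ^+ (pB a && ~~ pB b) *: \sum_(t <- lb a b) t.1 *: mon [:: (t.2, 0%N)] else 0.
  elim: (lb a b) => [|t l IH] /=; first by rewrite big_nil scaler0 if_same.
  rewrite chicls_cons IH big_cons eq_sym; case: eqP => _; last by rewrite addr0.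
  by rewrite scalerDr scalerA.
by case: j => [|[|j]] /=; rewrite ?addr0 ?add0r.
Qed.

(** The coefficient of $\chi^{j-1}$ contributes through $D\chi^{j-1}$ (a factor $-2$ if $j-1$ is
    odd) and through $\chi\chi^{j-1}$ (a factor 1). The total is $(-1)^{j-1}$ in both cases, which
    gives one uniform sign in front of the difference. *)
Lemma bdeltaS a j b m : bdelta a j (b, m.+1) = (-1) ^+ (pB a (+) odd j) *:
  (D (bdelta a j (b, m)) - prevc (fun j' => bdelta a j' (b, m)) j).
Proof.
rewrite /bdelta /brGen iterS chicls_scale chicls_cat chicls_chiD chicls_chimul.
rewrite signr_addb -scalerA; congr (_ *: _).
rewrite scalerBr -addrA; congr (_ + _).
case: j => [|j]; rewrite /prevc; first by rewrite scaler0 oppr0 addr0.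
rewrite /= -scaleNr -[X in _ + X]scale1r -scalerDl; congr (_ *: _).
by case: (odd j) => /=; rewrite ?add0r ?expr1 ?expr0 ?opprK // -[2]/(1 + 1) opprD addrNK.
Qed.

Lemma bdelta_homog a j g : homog ((pB a (+) odd j) (+) pg g) (bdelta a j g).
Proof.
case: g => b m; elim: m j => [|m IH] j.
  rewrite bdelta0 /Defs.pg /=; case: j => [|[|j]] /=.
  - apply: homogZ; rewrite big_seq; apply: homog_sum => t tl.
    have [->|nz] := eqVneq t.1 0; first by rewrite scale0r; exact: homog0.
    apply: homogZ; have := homog_gen K pB (t.2, 0%N).
    rewrite /Defs.pg /= (lb_par tl nz) !addbF.
    by case: (pB a) (pB b) => -[].
  - have [->|nz] := eqVneq (fm a b) 0; first by rewrite scale0r; exact: homog0.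
    by apply: homogZ; rewrite (fm_par nz); case: (pB b); exact: homog1.
  - exact: homog0.
rewrite bdeltaS.
have pgS : pg (b, m.+1) = ~~ pg (b, m).
  by rewrite /Defs.pg /=; case: (pB b) (odd m) => -[].
rewrite pgS addbN; apply: homogZ; apply: homogD; first by apply: D_homog.
apply: homogN; case: j => [|j] /=; first exact: homog0.
by rewrite addbN addNb negbK.
Qed.

(* The coefficient of chi^j in {a-bar _chi x} is a superderivation in x, of parity
   p(a) + j because chi is odd. *)
Definition bder (a : B) (j : nat) : R -> R := der (pB a (+) odd j) (bdelta a j).

Lemma bderM a j x y :
  bder a j (x * y) = bder a j x * y + spow (pB a (+) odd j) x * bder a j y.
Proof. exact: derM (bdelta_homog a j) x y. Qed.

Lemma bderD a j x y : bder a j (x + y) = bder a j x + bder a j y.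
Proof. exact: derD (bdelta_homog a j) x y. Qed.

Lemma bderZ a j c x : bder a j (c *: x) = c *: bder a j x.
Proof. exact: derZ (bdelta_homog a j) c x. Qed.

Lemma bder0 a j : bder a j 0 = 0.
Proof. exact: der0 (bdelta_homog a j). Qed.

Lemma bder1 a j : bder a j 1 = 0.
Proof. exact: der1 (bdelta_homog a j). Qed.

Lemma bder_gen a j g : bder a j (mon [:: g]) = bdelta a j g.
Proof. exact: der_gen (bdelta_homog a j) g. Qed.

Lemma spar_bder a j x : spar (bder a j x) = (-1) ^+ (pB a (+) odd j) *: bder a j (spar x).
Proof. exact: spar_der (bdelta_homog a j) x. Qed.

(* The coefficient of chi^j in sesquilinearity, with D chi + chi D = -2 chi^2. *)
Lemma bder_D a j x : bder a j (D x) = (-1) ^+ (pB a (+) odd j) *: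
  (D (bder a j x) - prevc (fun j' => bder a j' x) j).
Proof.
pose s := (-1) ^+ (pB a (+) odd j) : K.
(* Both sides of the identity obey the same twisted Leibniz rule, so it passes from two factors to
   their product; only generators remain, where it is [bdeltaS]. *)
have D_bder y z : (D (bder a j (y * z)) - prevc (fun j' => bder a j' (y * z)) j) =
   (D (bder a j y) - prevc (fun j' => bder a j' y) j) * z + spar (bder a j y) * D z
   + D (spow (pB a (+) odd j) y) * bder a j z +
   spow (~~ (pB a (+) odd j)) y * (D (bder a j z) - prevc (fun j' => bder a j' z) j).
  rewrite bderM DD !DM mulrBl mulrBr.
  have -> : prevc (fun j' => bder a j' (y * z)) j = prevc (fun j' => bder a j' y) j * z
     + spow (~~ (pB a (+) odd j)) y * prevc (fun j' => bder a j' z) j.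
    case: j {s} => [|j] /=; first by rewrite mul0r mulr0 addr0.
    by rewrite bderM addbN negbK.
  have -> : spar (spow (pB a (+) odd j) y) = spow (~~ (pB a (+) odd j)) y.
    by case: (pB a (+) odd j) => //=; rewrite sparK.
  rewrite opprD !addrA; congr (_ + _).
  by rewrite -!addrA; congr (_ + _); rewrite !addrA [LHS]addrC !addrA.
have main y z : (bder a j (D y) = s *: (D (bder a j y) - prevc (fun j' => bder a j' y) j)) ->
  (bder a j (D z) = s *: (D (bder a j z) - prevc (fun j' => bder a j' z) j)) ->
  (bder a j (D (y * z)) = s *: (D (bder a j (y * z)) - prevc (fun j' => bder a j' (y * z)) j)).
  move=> hy hz; rewrite D_bder DM bderD !bderM hy hz.
  move: (D (bder a j y) - _) (D (bder a j z) - _) => Y Z; rewrite !scalerDr !addrA.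
  have -> : bder a j (spar y) = s *: spar (bder a j y).
    by rewrite spar_bder scalerA -signr_addb addbb scale1r.
  have -> : spow (pB a (+) odd j) (D y) = s *: D (spow (pB a (+) odd j) y).
    by rewrite /s; case: (pB a (+) odd j); rewrite /= ?scale1r // spar_D expr1 scaleN1r.
  have -> : spow (pB a (+) odd j) (spar y) = spow (~~ (pB a (+) odd j)) y.
    by case: (pB a (+) odd j) => //=; rewrite sparK.
  by rewrite -!scalerAl -!scalerAr; congr (_ + _); rewrite addrAC.
elim/(@spW K B pB): x => [|c u x IHx].
  rewrite D0 !bder0 D0; case: j {s D_bder main} => [|j] /=; by rewrite ?bder0 subr0 scaler0.
rewrite DD !bderD DD IHx.
have -> : prevc (fun j' => bder a j' (c *: mon u + x)) j =
  prevc (fun j' => bder a j' (c *: mon u)) j + prevc (fun j' => bder a j' x) j.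
  by case: j {s D_bder main IHx} => [|j] /=; rewrite ?addr0 // bderD.
rewrite opprD addrACA [RHS]scalerDr; congr (_ + _).
have -> : prevc (fun j' => bder a j' (c *: mon u)) j = c *: prevc (fun j' => bder a j' (mon u)) j.
  by case: j {s D_bder main IHx} => [|j] /=; rewrite ?scaler0 // bderZ.
rewrite DZ !bderZ DZ -scalerBr scalerA mulrC -scalerA; congr (_ *: _).
elim: u {IHx c} => [|g u IHu].
  by rewrite mon0 D1 bder1 D0 bder0; case: j {s D_bder main} => [|j] /=; rewrite ?bder1 subr0 scaler0.
rewrite mon_cons; apply: main => //.
rewrite D_gen !bder_gen /Dg; case: g => b m; rewrite bdeltaS; congr (_ *: (_ - _)).
by case: j {s D_bder IHu} => [|j] //=; rewrite bder_gen.
Qed.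

Lemma chicls_brWord a w j : chicls (brWord pB lb fm a w) j = bder a j (mon w).
Proof.
rewrite /bder der_mon; last exact: bdelta_homog.
elim: w => [|y w IH] //=; rewrite chicls_cat addrC -IH; congr (_ + _).
  rewrite /bdelta; elim: (brGen _ _ _ _ _) => [|[i [c u]] X IHX] /=.
    by rewrite chicls_nil mul0r.
  rewrite !chicls_cons IHX mulrDl; congr (_ + _).
  by case: eqP => _; rewrite ?mul0r // mon_cat scalerAl.
elim: (brWord _ _ _ _ _) {IH} => [|[i [c u]] X IHX] /=.
  by rewrite chicls_nil mulr0 scaler0.
rewrite !chicls_cons IHX mulrDr scalerDr; congr (_ + _).
case: eqP => [->|_]; last by rewrite mulr0 scaler0.
by rewrite -scalerAr -mon_cons scalerA andb_addl.
Qed.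

Lemma cls_brV a x j : cls pB (chicoef (brV pB lb fm a x) j) = bder a j (cls pB x).
Proof.
rewrite -/(chicls _ _) /brV chicls_flatten clsE /evalv.
rewrite (big_morph _ (bderD a j) (bder0 a j)); apply: eq_bigr => t _.
by rewrite chicls_scale chicls_brWord bderZ.
Qed.

End Bracket.

(** * Subalgebras and elimination of a generator *)

Section Subalgebra.
Variables (K : numFieldType) (B : finType) (pB : B -> bool).
Notation R := (spoly K pB).
Notation D := (@D K B pB).
Notation spow := (@spow K B pB).
Implicit Type S : R -> Prop.

Inductive alg S : R -> Prop :=
| alg_gen x : S x -> alg S x
| alg_scalar c : alg S (c *: 1)
| alg_add x y : alg S x -> alg S y -> alg S (x + y)
| alg_mul x y : alg S x -> alg S y -> alg S (x * y).

Lemma alg1 S : alg S 1.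
Proof. by rewrite -[1]scale1r; exact: alg_scalar. Qed.

Lemma alg0 S : alg S 0.
Proof. by rewrite -(scale0r 1); exact: alg_scalar. Qed.

Lemma alg_scale S c x : alg S x -> alg S (c *: x).
Proof. by move=> Sx; rewrite -[x]mul1r scalerAl; apply: alg_mul => //; exact: alg_scalar. Qed.

Lemma alg_opp S x : alg S x -> alg S (- x).
Proof. by rewrite -scaleN1r; exact: alg_scale. Qed.

Lemma alg_sum S I (r : seq I) (P : pred I) (F : I -> R) :
  (forall i, P i -> alg S (F i)) -> alg S (\sum_(i <- r | P i) F i).
Proof. by move=> SF; elim/big_ind: _ => //; [exact: alg0|exact: alg_add]. Qed.

Lemma alg_sub S S' x : (forall z, S z -> alg S' z) -> alg S x -> alg S' x.
Proof.
move=> sub; elim=> [z /sub //|c|y z _ Sy _ Sz|y z _ Sy _ Sz].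
- exact: alg_scalar.
- exact: alg_add.
- exact: alg_mul.
Qed.

Definition homogenous S := forall x, S x -> exists b, homog b x.

Lemma alg_spow S b x : homogenous S -> alg S x -> alg S (spow b x).
Proof.
move=> hS; elim=> [z Sz|c|y z _ Sy _ Sz|y z _ Sy _ Sz].
- have [c hz] := hS z Sz; rewrite (homog_spow _ hz); exact/alg_scale/alg_gen.
- by rewrite spowZ spow1; exact: alg_scalar.
- by rewrite spowD; exact: alg_add.
- by rewrite spowM; exact: alg_mul.
Qed.

Lemma alg_D S x : homogenous S -> (forall z, S z -> alg S (D z)) ->
  alg S x -> alg S (D x).
Proof.
move=> hS DS; elim=> [z Sz|c|y z Sy SDy Sz SDz|y z Sy SDy Sz SDz].
- exact: DS.
- by rewrite DZ D1 scaler0; exact: alg0.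
- by rewrite DD; exact: alg_add.
- rewrite DM; apply: alg_add; first exact: alg_mul.
  by apply: alg_mul => //; exact: (alg_spow true).
Qed.

Section Elimination.
Variables (S : R -> Prop) (b : bool) (y : R) (c : K) (d : R -> R).
Hypotheses (hS : homogenous S) (hy : homog b y) (c0 : c != 0).
Let S' x := S x \/ x = y.
Hypothesis d_lin : linear d.
Hypothesis d1 : d 1 = 0.
(** The rule is asked only on the subalgebra because it will be applied to [rho] composed with a
    bracket coefficient, which is known to obey it where [rho] is the identity. *)
Hypothesis dM : forall x z, alg S' x -> alg S' z -> d (x * z) = d x * z + spow b x * d z.
Hypothesis dS : forall x, S x -> d x = 0.
Hypothesis dy : d y = c *: 1.

Let dD x z : d (x + z) = d x + d z.
Proof. by rewrite -[x]scale1r d_lin !scale1r. Qed.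
Let d0 : d 0 = 0.
Proof. by apply: (addrI (d 0)); rewrite -dD !addr0. Qed.
Let dZ a x : d (a *: x) = a *: d x.
Proof. by rewrite -[a *: x]addr0 d_lin d0 addr0. Qed.

Let SS' x : alg S x -> alg S' x.
Proof. by apply: alg_sub => z Sz; apply: alg_gen; left. Qed.

Let yS' : alg S' y.
Proof. by apply: alg_gen; right. Qed.

Let d_algS x : alg S x -> d x = 0.
Proof.
elim=> [z /dS //|a|u v _ du _ dv|u v Su du Sv dv].
- by rewrite dZ d1 scaler0.
- by rewrite dD du dv addr0.
- by rewrite dM ?du ?dv ?mul0r ?mulr0 ?addr0 //; exact: SS'.
Qed.

(** Horner form of a polynomial in [y], with powers of [y] on the left of the coefficients. *)
Let hor (l : seq R) : R := foldr (fun a h => a + y * h) 0 l.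
Let nf x := exists2 l, (forall a, a \in l -> alg S a) & x = hor l.

Let nf_cons a x : alg S a -> nf x -> nf (a + y * x).
Proof.
move=> Sa [l Sl ->]; exists (a :: l) => // z; rewrite inE => /predU1P[->//|].
exact: Sl.
Qed.

Let nf0 : nf 0.
Proof. by exists [::]. Qed.

Let nf_ind (P : R -> Prop) : P 0 ->
  (forall a x, alg S a -> nf x -> P x -> P (a + y * x)) -> forall x, nf x -> P x.
Proof.
move=> P0 PS x [l Sl ->]; elim: l Sl => [|a l IH] Sl //=.
have Sl' : forall a, a \in l -> alg S a by move=> z zl; apply: Sl; rewrite inE zl orbT.
apply: PS; [by apply: Sl; rewrite mem_head| by exists l | exact: IH].
Qed.

Let nf_alg a : alg S a -> nf a.
Proof. by move=> Sa; rewrite -[a]addr0 -(mulr0 y); exact: nf_cons. Qed.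

Let nf_add x z : nf x -> nf z -> nf (x + z).
Proof.
move=> nx; elim/nf_ind: x / nx z => [z|a x Sa nx IH z nz]; first by rewrite add0r.
elim/nf_ind: z / nz => [|e z Se nz _]; first by rewrite addr0; exact: nf_cons.
rewrite addrACA -mulrDr; apply: nf_cons; [exact: alg_add|exact: IH].
Qed.

Let yC a : a * y = y * spow b a.
Proof.
rewrite (homog_mulC _ hy).
by case: (b); rewrite /= ?sparK.
Qed.

Let nf_mull a x : alg S a -> nf x -> nf (a * x).
Proof.
move=> Sa nx; elim/nf_ind: x / nx a Sa => [a Sa|e x Se nx IH a Sa].
  by rewrite mulr0.
rewrite mulrDr mulrA yC -mulrA; apply: nf_cons; first exact: alg_mul.
by apply: IH; exact: alg_spow.
Qed.

Let nf_mul x z : nf x -> nf z -> nf (x * z).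
Proof.
move=> nx nz; elim/nf_ind: x / nx => [|a x Sa nx IH]; first by rewrite mul0r.
rewrite mulrDl -mulrA; apply: nf_add; first exact: nf_mull.
by rewrite -[y * _]add0r; apply: nf_cons => //; exact: alg0.
Qed.

Let nfP x : alg S' x -> nf x.
Proof.
elim=> [z [Sz|->]|a|u v _ Su _ Sv|u v _ Su _ Sv].
- exact/nf_alg/alg_gen.
- rewrite -[y]mulr1 -[_ * 1]add0r; apply: nf_cons; first exact: alg0.
  exact/nf_alg/alg1.
- exact/nf_alg/alg_scalar.
- exact: nf_add.
- exact: nf_mul.
Qed.

Let horE l : hor l = \sum_(i < size l) y ^+ i * l`_i.
Proof.
elim: l => [|a l IH] /=; first by rewrite big_ord0.
rewrite big_ord_recl expr0 mul1r IH mulr_sumr; congr (_ + _).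
by apply: eq_bigr => i _; rewrite mulrA -exprS.
Qed.

Let yiS' i : alg S' (y ^+ i).
Proof.
by elim: i => [|i IH]; rewrite ?expr0 ?exprS; [exact: alg1|exact: alg_mul].
Qed.

Let d_pow i : b = false -> d (y ^+ i.+1) = (c * i.+1%:R) *: y ^+ i.
Proof.
move=> bF; elim: i => [|i IH]; first by rewrite expr1 expr0 mulr1.
rewrite exprS dM // IH bF /= dy -scalerAl mul1r -scalerAr -exprS -scalerDl.
by rewrite -[in RHS]natr1 mulrDr mulr1 addrC.
Qed.

Let dhor l : b = false -> (forall a, a \in l -> alg S a) ->
  d (hor l) = c *: \sum_(i < (size l).-1) y ^+ i * (i.+1%:R *: l`_i.+1).
Proof.
move=> bF Sl; rewrite horE (big_morph d dD d0).
case: l Sl => [|a l] Sl /=; first by rewrite !big_ord0 scaler0.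
rewrite big_ord_recl expr0 mul1r d_algS ?add0r; last by apply: Sl; rewrite mem_head.
rewrite scaler_sumr; apply: eq_bigr => i _ /=.
have Si : alg S l`_i by apply: Sl; rewrite inE mem_nth ?orbT.
rewrite dM //; last exact: SS'.
by rewrite (d_algS Si) mulr0 addr0 d_pow // -scalerAl -scalerAr scalerA.
Qed.

(** Independence of the powers of an even [y] over [alg S]: applying [d] to a relation gives a
    shorter one with coefficients $(i+1)l_{i+1}$, so induction on the length and characteristic zero
    apply. *)
Let hor_eq0 l : b = false -> (forall a, a \in l -> alg S a) ->
  hor l = 0 -> forall i, l`_i = 0.
Proof.
move=> bF; have [n] := ubnP (size l); elim: n l => // n IH [|a l] sl Sl hl i.
  by rewrite nth_nil.
have Sl' z : z \in l -> alg S z by move=> zl; apply: Sl; rewrite inE zl orbT.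
have li j : l`_j = 0.
  have := dhor bF Sl; rewrite hl d0 /= => /esym /eqP.
  rewrite scaler_eq0 (negPf c0) /= => /eqP E.
  pose m := mkseq (fun i => i.+1%:R *: l`_i) (size l).
  have hm : hor m = 0.
    rewrite horE -[RHS]E size_mkseq; apply: eq_bigr => k _.
    by rewrite nth_mkseq.
  have [jl|jl] := ltnP j (size l); last by rewrite nth_default.
  have := IH m _ _ hm j; rewrite nth_mkseq // => /(_ _ _)/eqP.
  rewrite scaler_eq0 pnatr_eq0 /= => H; apply/eqP/H.
    by rewrite size_mkseq -ltnS.
  move=> z /mapP[k]; rewrite mem_iota => /andP[_ kl] ->.
  by apply: alg_scale; apply: Sl'; rewrite mem_nth.
case: i => [|i] //=; move: hl; rewrite /= horE big1 ?mulr0 ?addr0 //.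
by move=> k _; rewrite li mulr0.
Qed.

(* Write x = \sum_i y^i A_i with A_i in alg S. Since d is alg S-linear and d y = c,
   d acts as c times the partial derivative in y, so d x = 0 forces A_i = 0 for
   i > 0 in characteristic zero. *)
Lemma alg_elim x : alg S' x -> d x = 0 -> alg S x.
Proof.
move=> /nfP [l Sl ->]; case bE: b.
  case: l Sl => [|a l] Sl /=; first by move=> _; exact: alg0.
  (* For odd [y] the square vanishes, so the Horner form reduces to $a+ya'$, and
     $d(a+ya')=c\,a'$. *)
  have yy : y * y = 0.
    have := homog_supercomm hy hy; rewrite bE expr1 scaleN1r => /eqP.
    rewrite -addr_eq0 -mulr2n -scaler_nat scaler_eq0 pnatr_eq0 /=.
    by move/eqP.
  have Sa : alg S a by apply: Sl; rewrite mem_head.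
  case: l Sl => [|a' l] Sl /=; first by rewrite mulr0 addr0.
  have Sa' : alg S a' by apply: Sl; rewrite !inE eqxx orbT.
  rewrite mulrDr [y * (y * _)]mulrA yy mul0r addr0 dD dM //; last exact: SS'.
  rewrite (d_algS Sa) (d_algS Sa') mulr0 addr0 add0r dy -scalerAl mul1r => /eqP.
  by rewrite scaler_eq0 (negPf c0) /= => /eqP ->; rewrite mulr0 addr0.
case: l Sl => [|a l] Sl; first by move=> _; exact: alg0.
rewrite dhor // => /eqP; rewrite scaler_eq0 (negPf c0) /= => /eqP E.
have Sl' z : z \in l -> alg S z by move=> zl; apply: Sl; rewrite inE zl orbT.
pose m := mkseq (fun i => i.+1%:R *: l`_i) (size l).
have hm : hor m = 0.
  rewrite horE -[RHS]E size_mkseq; apply: eq_bigr => k _.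
  by rewrite nth_mkseq.
have Sm z : z \in m -> alg S z.
  move=> /mapP[k]; rewrite mem_iota => /andP[_ kl] ->.
  by apply: alg_scale; apply: Sl'; rewrite mem_nth.
have li k : l`_k = 0.
  have [kl|kl] := ltnP k (size l); last by rewrite nth_default.
  have := hor_eq0 bE Sm hm k; rewrite nth_mkseq // => /eqP.
  by rewrite scaler_eq0 pnatr_eq0 => /eqP.
rewrite /= horE big1 ?mulr0 ?addr0; last by move=> k _; rewrite li mulr0.
by apply: Sl; rewrite mem_head.
Qed.

End Elimination.
End Subalgebra.

(** * Reduction modulo the ideal J *)

Section Reduction.
Variables (K : numFieldType) (B : finType) (pB : B -> bool).
Notation gen := (gen B).
Notation word := (word B).
Notation pg := (pg pB).
Notation R := (spoly K pB).
Notation mon := (@mon K B pB).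
Notation D := (@D K B pB).
Notation spow := (@spow K B pB).
Variables (nb : pred B) (fc : B -> K).
Hypothesis fc_par : forall b, fc b != 0 -> pB b.

(* [fc b] stands for (f|b), so that [rho] is the retraction of V(g-bar) onto
   V(p-bar) with kernel J. *)
Definition redgen (g : gen) : R :=
  if nb g.1 then (if g.2 == 0%N then fc g.1 else 0) *: 1 else mon [:: g].

(** [fc b] is nonzero only for odd [b], whose generator $\bar b$ is even like a scalar; hence the
    substitution preserves parity. *)
Lemma redgen_homog g : homog (pg g) (redgen g).
Proof.
rewrite /redgen; case: ifP => _; last exact: homog_gen.
case: g => b [|m] /=; last by rewrite scale0r; exact: homog0.
have [->|nz] := eqVneq (fc b) 0; first by rewrite scale0r; exact: homog0.
by rewrite /Defs.pg /= (fc_par nz); apply/homogZ/homog1.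
Qed.

Definition rho : R -> R := shom redgen.

HB.instance Definition _ := GRing.isLinear.Build K R R _ rho (shom_linear redgen_homog).

Lemma rhoD x y : rho (x + y) = rho x + rho y. Proof. exact: linearD. Qed.
Lemma rhoZ c x : rho (c *: x) = c *: rho x. Proof. exact: linearZ. Qed.
Lemma rho0 : rho 0 = 0. Proof. exact: linear0. Qed.
Lemma rhoM x y : rho (x * y) = rho x * rho y. Proof. exact: shomM redgen_homog x y. Qed.
Lemma rho_mon w : rho (mon w) = homw redgen w. Proof. exact: shom_mon redgen_homog w. Qed.
Lemma rho1 : rho 1 = 1. Proof. by rewrite -mon0 rho_mon. Qed.
Lemma rho_gen g : rho (mon [:: g]) = redgen g.
Proof. by rewrite rho_mon /homw /= mulr1. Qed.

Lemma rho_redgen g : rho (redgen g) = redgen g.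
Proof.
rewrite {1}/redgen; case: ifP => nbg; first by rewrite rhoZ rho1 /redgen nbg.
exact: rho_gen.
Qed.

Lemma spar_rho x : spar (rho x) = rho (spar x).
Proof.
elim/(@spW K B pB): x => [|c u x IHx]; first by rewrite !raddf0.
rewrite rhoD !sparD rhoD IHx rhoZ !sparZ rhoZ; congr (_ *: _ + _).
rewrite spar_mon rhoZ rho_mon; exact: homw_homog redgen_homog u.
Qed.

Lemma spow_rho b x : spow b (rho x) = rho (spow b x).
Proof. by case: b => //=; exact: spar_rho. Qed.

Lemma rho_D x : rho (D x) = D (rho x).
Proof.
elim/(@spW K B pB): x => [|c u x IHx]; first by rewrite !raddf0.
rewrite !(DD, rhoD) IHx !(DZ, rhoZ); congr (_ *: _ + _).
elim: u => [|g u IH]; first by rewrite mon0 D1 rho0 rho1 D1.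
rewrite mon_cons rhoM !DM rhoD !rhoM IH D_gen !rho_gen -spar_rho rho_gen.
congr (_ * _ + _); rewrite /redgen /=; case: ifP => _; last by rewrite D_gen.
by rewrite scale0r DZ D1 scaler0.
Qed.

(** Left multiples already give a two-sided ideal, since each relation is homogeneous. It is a
    differential ideal because the relations for all $D^m\bar n$ are included, and for $m>0$ the
    constant is 0. *)
Definition ideal (x : R) := exists l : seq (R * gen),
  all (fun t => nb t.2.1) l /\ x = \sum_(t <- l) t.1 * (mon [:: t.2] - redgen t.2).

Lemma ideal0 : ideal 0.
Proof. by exists [::]; rewrite big_nil. Qed.

Lemma idealD x y : ideal x -> ideal y -> ideal (x + y).
Proof.
move=> [l [al ->]] [l' [al' ->]]; exists (l ++ l').
by rewrite all_cat al al' big_cat.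
Qed.

Lemma idealM z x : ideal x -> ideal (z * x).
Proof.
move=> [l [al ->]]; exists [seq (z * t.1, t.2) | t <- l]; split.
  by rewrite all_map.
by rewrite big_map mulr_sumr; apply: eq_bigr => t _; rewrite mulrA.
Qed.

Lemma ideal_sub_rho x : ideal (x - rho x).
Proof.
elim/(@spW K B pB): x => [|c u x IHx]; first by rewrite rho0 subr0; exact: ideal0.
rewrite rhoD opprD addrACA; apply: idealD IHx.
rewrite rhoZ -scalerBr -[mon u - _]mul1r scalerAl; apply: idealM.
elim: u => [|g u IH]; first by rewrite mon0 rho1 subrr; exact: ideal0.
rewrite mon_cons rhoM rho_gen.
have -> : mon [:: g] * mon u - redgen g * rho (mon u) =
  mon [:: g] * (mon u - rho (mon u)) + (mon [:: g] - redgen g) * rho (mon u).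
  by rewrite mulrBr mulrBl addrA subrK.
apply: idealD; first exact: idealM.
have hg : homog (pg g) (mon [:: g] - redgen g).
  by apply: homogD; [exact: homog_gen|apply/homogN/redgen_homog].
rewrite (homog_mulC _ hg); apply: idealM.
have [nbg|nbg] := boolP (nb g.1).
  by exists [:: (1, g)]; rewrite /= nbg big_seq1 mul1r.
by rewrite /redgen (negPf nbg) subrr; exact: ideal0.
Qed.

Lemma idealP x : ideal x <-> rho x = 0.
Proof.
split=> [[l [_ ->]]|rx].
  rewrite raddf_sum big1 // => t _ /=.
  by rewrite rhoM raddfB /= rho_gen rho_redgen subrr mulr0.
by have := ideal_sub_rho x; rewrite rx subr0.
Qed.

Lemma homw_redgen w : exists c w', all (fun g : gen => ~~ nb g.1) w' /\
  homw redgen w = c *: mon w'.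
Proof.
elim: w => [|g w [c [w' [aw E]]]].
  by exists 1, [::]; rewrite scale1r.
have -> : homw redgen (g :: w) = redgen g * homw redgen w by [].
rewrite E /redgen; case: ifP => nbg.
  exists ((if g.2 == 0%N then fc g.1 else 0) * c), w'; split=> //.
  by rewrite -scalerAl mul1r scalerA.
exists c, (g :: w'); rewrite /= nbg; split=> //.
by rewrite -scalerAr -mon_cons.
Qed.

(** In one direction [x] is expanded over its sorted words, each of which [rho] fixes. In the other,
    $\rho(x)$ is a combination of monomials without letters from n, so its coefficient at any other
    word is 0. *)
Lemma inVp_rho (x : V K B) :
  (forall m, coef pB x m != 0 -> all (fun g : gen => ~~ nb g.1) m) <->
  rho (cls pB x) = cls pB x.
Proof.
split=> H.
  pose S := undup [seq sortw t.2 | t <- x].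
  have E : cls pB x = \sum_(m <- S) coef pB x m *: mon m.
    rewrite clsE; apply: evalv_coef; [exact: swapping_mon|exact: undup_uniq|].
    by move=> m; rewrite mem_undup.
  rewrite E raddf_sum; apply: eq_bigr => m _ /=; rewrite rhoZ.
  have [->|/H am] := eqVneq (coef pB x m) 0; first by rewrite !scale0r.
  congr (_ *: _); rewrite rho_mon; elim: m am => [|g m IH] //= /andP[ng am].
  have -> : homw redgen (g :: m) = redgen g * homw redgen m by [].
  by rewrite IH // /redgen (negPf ng) -mon_cons.
move=> m; rewrite coef_evalv -(linE _ (@swapping_coefw K B pB m)) -H => nz.
apply/negPn/negP => nm; case/eqP: nz.
have sc := @swapping_coefw K B pB m.
rewrite clsE /evalv raddf_sum /=.
pose F : R -> K^o := lin (coefw K pB m : word -> K^o).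
have L : linear F := lin_linear sc.
have LD : {morph F : y z / y + z}.
  by move=> y z; rewrite -[y]scale1r L !scale1r.
have L0 : F 0 = 0 by apply: (addrI (F 0)); rewrite -LD !addr0.
rewrite -/F (big_morph _ LD L0) big1 // => t _.
rewrite rhoZ rho_mon; have [c [w' [aw ->]]] := homw_redgen t.2.
rewrite scalerA -[_ *: mon w']addr0 L L0 addr0 /F lin_mon //.
rewrite /coefw; case: eqP => [wm|]; last by rewrite scaler0.
by case/negP: nm; rewrite -wm (eq_all_r (s2 := w')) // => g; rewrite mem_sort.
Qed.

Variables (lb : B -> B -> seq (K * B)) (fm : B -> B -> K).
Hypothesis lb_par : forall a b t, t \in lb a b -> t.1 != 0 -> pB t.2 = pB a (+) pB b.
Hypothesis fm_par : forall a b, fm a b != 0 -> pB a = pB b.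
Notation bder := (@bder K B pB lb fm).

Definition rder (a : B) (j : nat) (x : R) : R := rho (bder a j x).

Lemma rderD a j x y : rder a j (x + y) = rder a j x + rder a j y.
Proof. by rewrite /rder bderD // rhoD. Qed.

Lemma rderZ a j c x : rder a j (c *: x) = c *: rder a j x.
Proof. by rewrite /rder bderZ // rhoZ. Qed.

Lemma rder0 a j : rder a j 0 = 0.
Proof. by rewrite /rder bder0 // rho0. Qed.

Lemma rder1 a j : rder a j 1 = 0.
Proof. by rewrite /rder bder1 // rho0. Qed.

(** A Leibniz rule relative to [rho]; on arguments fixed by [rho] it is the usual one. *)
Lemma rderM a j x y : rder a j (x * y) =
  rder a j x * rho y + spow (pB a (+) odd j) (rho x) * rder a j y.
Proof. by rewrite /rder bderM // rhoD !rhoM spow_rho. Qed.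

Lemma rder_D a j x : rder a j (D x) = (-1) ^+ (pB a (+) odd j) *:
  (D (rder a j x) - prevc (fun j' => rder a j' x) j).
Proof.
rewrite /rder bder_D // rhoZ raddfB /= rho_D; congr (_ *: (_ - _)).
by case: j => [|j] //=; rewrite rho0.
Qed.

Lemma spar_rder a j x :
  rder a j (spar x) = (-1) ^+ (pB a (+) odd j) *: spar (rder a j x).
Proof.
by rewrite /rder spar_rho spar_bder // rhoZ scalerA -signr_addb addbb scale1r.
Qed.

Lemma alg_rho S x : (forall z, S z -> rho z = z) -> alg S x -> rho x = x.
Proof.
move=> HS; elim=> [z /HS //|c|u v _ du _ dv|u v Su du Sv dv].
- by rewrite rhoZ rho1.
- by rewrite rhoD du dv.
- by rewrite rhoM du dv.
Qed.

Lemma alg_rder S a j x : (forall z, S z -> rho z = z /\ rder a j z = 0) ->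
  alg S x -> rder a j x = 0.
Proof.
move=> HS; elim=> [z /HS[] //|c|u v _ du _ dv|u v Su du Sv dv].
- by rewrite rderZ rder1 scaler0.
- by rewrite rderD du dv addr0.
- by rewrite rderM du dv mul0r mulr0 addr0.
Qed.

End Reduction.

(** * Row determinants of Hessenberg matrices of operators *)

Section RowDeterminant.
Variables (S : nzRingType) (M : lmodType S) (v0 : M).
Implicit Type a : nat -> nat -> M -> M.

(** The entries are operators on a module and the ordered product of a permutation is applied to
    [v0], so noncommuting entries cause no trouble. Indices are natural numbers so that minors are
    mere reindexings. *)
Definition rowdet (m : nat) a : M :=
  \sum_(s : 'S_m) (-1) ^+ s *: foldr (fun i : 'I_m => a i (s i)) v0 (enum 'I_m).

Definition opadd a := forall i j x y, a i j (x + y) = a i j x + a i j y.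

Lemma opadd0 a i j : opadd a -> a i j 0 = 0.
Proof. by move=> ad; apply: (addrI (a i j 0)); rewrite -ad !addr0. Qed.

Lemma opadd_sign a i j (b : bool) x :
  opadd a -> a i j ((-1) ^+ b *: x) = (-1) ^+ b *: a i j x.
Proof.
move=> ad; case: b; rewrite ?scale1r // expr1 !scaleN1r.
by apply: (addrI (a i j x)); rewrite -ad !subrr opadd0.
Qed.

Lemma eq_rowdet m a b : (forall i j x, a i j x = b i j x) -> rowdet m a = rowdet m b.
Proof.
move=> ab; apply: eq_bigr => s _; congr (_ *: _).
by elim: (enum _) => //= i l ->; rewrite ab.
Qed.

Lemma rowdet0 a : rowdet 0 a = v0.
Proof.
rewrite /rowdet (bigD1 (1%g : 'S_0)) //= big1 => [|s].
  by rewrite odd_perm1 scale1r addr0 (size0nil (s := enum 'I_0)) // size_enum_ord.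
by case/eqP; apply/permP => -[].
Qed.

(** The factor from row 0 is the outermost one in every product, so expansion along that row
    survives noncommutativity. A permutation corresponds to the image [j] of 0 together with a
    permutation of the rest. *)
Lemma rowdet_laplace m a : opadd a -> rowdet m.+1 a =
  \sum_(j < m.+1) (-1) ^+ odd j *: a 0%N j (rowdet m (fun i c => a i.+1 (bump j c))).
Proof.
move=> ad; pose phi (u : 'I_m.+1 * 'S_m) := lift_perm ord0 u.1 u.2.
have phi_bij : bijective phi.
  apply: inj_card_bij; last by rewrite card_prod !card_Sn card_ord factS.
  move=> [j s] [k t] E; have {}E x : lift_perm ord0 j s x = lift_perm ord0 k t x.
    exact: (congr1 (fun u : 'S_m.+1 => u x) E).
  have jk : j = k by have := E ord0; rewrite !lift_perm_id.
  rewrite {}jk in E *; congr (_, _); apply/permP => i; apply: (@lift_inj _ k).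
  by have := E (lift ord0 i); rewrite !lift_perm_lift.
pose F (s : 'S_m.+1) := (-1) ^+ s *: foldr (fun i : 'I_m.+1 => a i (s i)) v0 (enum 'I_m.+1).
transitivity (\sum_j \sum_s F (lift_perm ord0 j s)).
  by rewrite pair_bigA /rowdet (reindex phi (onW_bij _ phi_bij)).
apply: eq_bigr => j _; rewrite /F /rowdet.
rewrite (big_morph (a 0%N j) (ad 0%N j) (opadd0 0%N j ad)) scaler_sumr.
apply: eq_bigr => s _.
rewrite opadd_sign // scalerA odd_lift_perm /= signr_addb; congr (_ *: _).
rewrite enum_ordSl /= lift_perm_id; congr (a _ _ _).
rewrite foldr_map; elim: (enum 'I_m) => //= i l ->.
by rewrite lift_perm_lift.
Qed.

Lemma rowdet_col0 m a : opadd a -> (forall i x, a i 0%N x = 0) -> rowdet m.+1 a = 0.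
Proof.
move=> ad a0; apply: big1 => s _.
suff -> : foldr (fun i : 'I_m.+1 => a i (s i)) v0 (enum 'I_m.+1) = 0 by rewrite scaler0.
have : (s^-1%g ord0) \in enum 'I_m.+1 by rewrite mem_enum.
elim: (enum _) => //= i l IH; rewrite inE => /predU1P[<-|/IH ->]; last exact: opadd0.
by rewrite permKV a0.
Qed.

Lemma rowdet_block m a : opadd a -> (forall i x, a i.+1 0%N x = 0) ->
  rowdet m.+1 a = a 0%N 0%N (rowdet m (fun i c => a i.+1 c.+1)).
Proof.
move=> ad a0; rewrite rowdet_laplace // big_ord_recl /= scale1r big1 ?addr0 //.
case: m => [[] //|m] j _; rewrite rowdet_col0 ?opadd0 ?scaler0 // => i c x y.
Qed.

Definition hessenberg a := (forall i j x, (j.+1 < i)%N -> a i j x = 0) /\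
  (forall j x, a j.+1 j x = - x).

(** Without row 0 and column [j], the first [j] columns are upper triangular with diagonal entries
    $-1$. The resulting sign $(-1)^j$ cancels the one of the row expansion, so the recursion
    [rowdet_hessenberg] has no signs. *)
Lemma rowdet_hess_minor m a j : opadd a -> hessenberg a -> (j <= m)%N ->
  rowdet m (fun i c => a i.+1 (bump j c)) =
  (-1) ^+ odd j *: rowdet (m - j) (fun i c => a (i + j.+1)%N (c + j.+1)%N).
Proof.
elim: j m a => [|j IH] m a ad [a0 a1] jm.
  rewrite scale1r subn0; apply: eq_rowdet => i c x.
  by rewrite !addn1.
case: m jm => // m jm; rewrite rowdet_block; first last.
- by move=> i x; apply: a0.
- by move=> i c; exact: ad.
rewrite /= a1 signrN scaleNr subSS; congr (- _).
pose b i c := a i.+1 c.+1.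
have bd : opadd b by move=> i c; exact: ad.
have bh : hessenberg b by split=> [i c x ic|c x]; [exact: a0|exact: a1].
transitivity (rowdet m (fun i c => b i.+1 (bump j c))).
  by apply: eq_rowdet => i c x; rewrite /b /bump ltnS addnS.
rewrite (IH m b bd bh jm); congr (_ *: _).
by apply: eq_rowdet => i c x; rewrite /b !addnS.
Qed.

Lemma rowdet_hessenberg N a o : opadd a -> hessenberg a -> (o < N)%N ->
  rowdet (N - o) (fun i c => a (i + o)%N (c + o)%N) =
  \sum_(o <= j < N) a o j (rowdet (N - j.+1) (fun i c => a (i + j.+1)%N (c + j.+1)%N)).
Proof.
move=> ad [a0 a1] oN.
have ado : opadd (fun i c => a (i + o)%N (c + o)%N) by move=> i c; exact: ad.
have ho : hessenberg (fun i c => a (i + o)%N (c + o)%N).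
  by split=> [i c x ic|c x]; [apply: a0; rewrite -addSn ltn_add2r|exact: a1].
have [m NE] : exists m, N = (m.+1 + o)%N.
  by exists (N - o.+1)%N; rewrite addSn -addnS subnK.
rewrite {oN}NE addnK -[X in bigop _ (index_iota X _)]add0n big_addn addnK big_mkord rowdet_laplace //.
apply: eq_bigr => j _; have jm : (j <= m)%N by rewrite -ltnS.
rewrite (rowdet_hess_minor ado ho jm) opadd_sign // scalerA -signr_addb addbb scale1r.
congr (a _ _ _); have -> : (m.+1 + o - (j + o).+1 = m - j)%N by rewrite addSn subSS subnDr.
by apply: eq_rowdet => i c x; rewrite -!addnA addSn.
Qed.

End RowDeterminant.

(** * The Lie superalgebra sl(n+1|n) *)

Section SpecialLinear.
Variables (K : numFieldType) (n : nat).
Notation N := (NN n).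
Notation psl := (@psl n).
Notation R := (spoly K psl).
Notation mon := (@mon K (Bsl n) psl).
Notation D := (@D K (Bsl n) psl).
Notation str := (@str K n).
Notation slmat := (@slmat K n).
Notation coord := Defs.coord.
Implicit Types (X Y : 'M[K]_N) (b : Bsl n) (i j k l : 'I_N).

Definition mxpar (p : bool) X := forall i j, X i j != 0 -> par i (+) par j = p.

Lemma mxparM p q X Y : mxpar p X -> mxpar q Y -> mxpar (p (+) q) (X *m Y).
Proof.
move=> hX hY i j nz; have /existsP[k] : [exists k, X i k * Y k j != 0].
  apply: contraNT nz => /existsPn H; rewrite mxE big1 // => k _.
  by apply/eqP; rewrite -[_ == _]negbK; exact: H.
rewrite mulf_eq0 negb_or => /andP[/hX <- /hY <-].
by rewrite addbA addbK.
Qed.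

Lemma mxparD p X Y : mxpar p X -> mxpar p Y -> mxpar p (X + Y).
Proof.
move=> hX hY i j; rewrite mxE => nz; have [X0|/hX //] := eqVneq (X i j) 0.
by apply: hY; rewrite X0 add0r in nz.
Qed.

Lemma mxparZ p c X : mxpar p X -> mxpar p (c *: X).
Proof.
by move=> hX i j; rewrite mxE mulf_eq0 negb_or => /andP[_ /hX].
Qed.

Lemma mxpar_delta i j : mxpar (par i (+) par j) (delta_mx i j).
Proof.
move=> k l; rewrite mxE; case: andP => [[/eqP -> /eqP ->] //|].
by rewrite eqxx.
Qed.

Lemma mxpar_slmat b : mxpar (psl b) (slmat b).
Proof.
case: b => [[[i j] /= _]|k] /=; first exact: mxpar_delta.
rewrite -[false](addbb (par (widen_ord (leqnSn _) k))); apply: mxparD; first exact: mxpar_delta.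
rewrite addbb -(addbb (par (lift ord0 k))); exact: mxpar_delta.
Qed.

Lemma mxpar_fmat : mxpar true (fmat K n).
Proof.
rewrite /fmat; elim/big_ind: _ => [i j|X Y|i i2n]; last 2 first.
- exact: mxparD.
- move=> k l; rewrite mxE; case: andP => [[/eqP -> /eqP ->] _|]; last by rewrite eqxx.
  by rewrite /par inordK ?ltnS //= addNb addbb.
by rewrite mxE eqxx.
Qed.

Lemma str_mxpar p X : mxpar p X -> str X != 0 -> p = false.
Proof.
move=> hX; rewrite /Defs.str => nz.
have /existsP[i] : [exists i, X i i != 0].
  apply: contraNT nz => /existsPn H; rewrite big1 // => i _.
  by have := H i; rewrite negbK => /eqP ->; rewrite mulr0.
by move/hX; rewrite addbb.
Qed.

Lemma coord_mxpar p X b : mxpar p X -> coord X b != 0 -> psl b = p.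
Proof.
move=> hX; case: b => [[[i j] /= _]|k] /= nz; first exact: hX.
have /existsP[i] : [exists i, X i i != 0].
  apply: contraNT nz => /existsPn H; rewrite big1 // => i _.
  by have := H i; rewrite negbK => /eqP ->; rewrite mulr0.
by move/hX; rewrite addbb.
Qed.

Lemma slbr_par a b t : t \in slbr K a b -> t.1 != 0 -> psl t.2 = psl a (+) psl b.
Proof.
move=> /mapP[c _ ->] /=; apply: coord_mxpar; apply: mxparD.
  by apply: mxparM; exact: mxpar_slmat.
rewrite -scaleNr; apply: mxparZ; rewrite addbC.
by apply: mxparM; exact: mxpar_slmat.
Qed.

Lemma slform_par a b : slform K a b != 0 -> psl a = psl b.
Proof.
move=> /(str_mxpar (mxparM (@mxpar_slmat a) (@mxpar_slmat b))).
by case: psl (psl b) => -[].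
Qed.

Definition fcoef b : K := str (fmat K n *m slmat b).

Lemma fcoef_par b : fcoef b != 0 -> psl b.
Proof.
move=> /(str_mxpar (mxparM mxpar_fmat (@mxpar_slmat b))) /=.
by case: psl.
Qed.

Lemma strD X Y : str (X + Y) = str X + str Y.
Proof.
by rewrite /Defs.str -big_split; apply: eq_bigr => i _; rewrite mxE mulrDr.
Qed.

Lemma strZ c X : str (c *: X) = c * str X.
Proof.
by rewrite /Defs.str mulr_sumr; apply: eq_bigr => i _; rewrite mxE mulrCA.
Qed.

Lemma str_delta i j : str (delta_mx i j) = (i == j)%:R * (-1) ^+ par i.
Proof.
rewrite /Defs.str (bigD1 i) //= mxE eqxx /= mulrC big1 ?addr0 // => k ki.
by rewrite mxE (negPf ki) mulr0.
Qed.

Lemma str1 : str 1%:M = 1.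
Proof.
rewrite /Defs.str; under eq_bigr do rewrite mxE eqxx mulr1.
rewrite /par /NN; elim: n => [|m IH]; first by rewrite big_ord1.
by rewrite doubleS 2!big_ord_recr /= IH odd_double /= expr0 expr1 addrNK.
Qed.

Lemma coord_linear b c X Y : coord (c *: X + Y) b = c * coord X b + coord Y b.
Proof.
case: b => [ij|k] /=; first by rewrite !mxE.
rewrite mulr_sumr -big_split; apply: eq_bigr => j _ /=.
by rewrite !mxE mulrDr mulrCA.
Qed.

(** The map $X\mapsto\bar X$. It is faithful only for supertrace zero: the coordinates ignore the
    last diagonal entry. *)
Definition ell X : R := \sum_b coord X b *: mon [:: (b, 0%N)].

Lemma ell_linear : linear ell.
Proof.
move=> c X Y; rewrite /ell scaler_sumr -big_split; apply: eq_bigr => b _ /=.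
by rewrite coord_linear scalerDl scalerA.
Qed.

HB.instance Definition _ := GRing.isLinear.Build K 'M[K]_N R _ ell ell_linear.

Lemma ell_sum I (r : seq I) (P : pred I) (F : I -> 'M[K]_N) :
  ell (\sum_(i <- r | P i) F i) = \sum_(i <- r | P i) ell (F i).
Proof. exact: raddf_sum. Qed.

Lemma ellZ c X : ell (c *: X) = c *: ell X.
Proof. exact: linearZ. Qed.

Lemma iter_D_gen b m : iter m D (mon [:: (b, 0%N)]) = mon [:: (b, m)].
Proof. by elim: m => //= m ->; rewrite D_gen. Qed.

Lemma iter_DD m : {morph iter m D : x y / x + y}.
Proof. by elim: m => // m IH x y; rewrite !iterS IH DD. Qed.

Lemma iter_D0 m : iter m D 0 = 0.
Proof. by elim: m => //= m ->; rewrite D0. Qed.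

Lemma iter_DZ m c x : iter m D (c *: x) = c *: iter m D x.
Proof. by elim: m => //= m ->; rewrite DZ. Qed.

Lemma cls_ovl X m : cls psl [seq (t.1, [:: (t.2, m)]) | t <- ovl X] = iter m D (ell X).
Proof.
rewrite clsE /evalv /ovl !big_map -enumT big_enum /ell.
rewrite (big_morph _ (iter_DD m) (iter_D0 m)); apply: eq_bigr => b _ /=.
by rewrite iter_DZ iter_D_gen.
Qed.

Lemma eq_inl (x y : offd n) : (inl x == inl y :> Bsl n) = (x == y).
Proof. by apply/eqP/eqP => [[]|->]. Qed.

Lemma eq_inr (x y : 'I_(n.*2)) : (inr x == inr y :> Bsl n) = (x == y).
Proof. by apply/eqP/eqP => [[]|->]. Qed.

(** On the diagonal the coordinates are alternating partial sums: the two entries of $h_k$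
    contribute opposite signs if both are included, neither if $k'<k$, and only the first one if
    $k'=k$. *)
Lemma coord_slmat b b' : coord (slmat b) b' = (b == b')%:R.
Proof.
case: b b' => [[[i j] ij]|k] [[[i' j'] ij']|k'] /=.
- by rewrite mxE eq_inl -[in RHS]val_eqE /= xpair_eqE (eq_sym i) (eq_sym j).
- rewrite big1 // => l _; rewrite mxE; case: andP => [[/eqP E1 /eqP E2]|]; last by rewrite mulr0.
  by move: ij; rewrite /= -E1 -E2 eqxx.
- rewrite !mxE; case: andP => [[/eqP E1 /eqP E2]|_].
    by move: ij'; rewrite /= E1 E2 eqxx.
  case: andP => [[/eqP E1 /eqP E2]|_]; last by rewrite addr0.
  by move: ij'; rewrite /= E1 E2 eqxx.
rewrite eq_inr.
rewrite (eq_bigr (fun j : 'I_N => (if j == k :> nat then (-1) ^+ (k' - k) else 0)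
   + (if j == k.+1 :> nat then (-1) ^+ (k' - k.+1) else 0 : K))); last first.
  move=> j _; rewrite !mxE !andbb mulrDr -!val_eqE /= /bump /= add1n.
  by congr (_ + _); case: eqP => [->|_]; rewrite ?mulr1 ?mulr0.
rewrite big_split /= -!big_mkcondr /=.
have sumE (m : nat) (c : K) : (m < N)%N ->
    \sum_(j < N | (j <= k')%N && (j == m :> nat)) c = if (m <= k')%N then c else 0.
  move=> mN; rewrite big_mkcond (bigD1 (Ordinal mN)) //= eqxx andbT big1 ?addr0 //.
  by move=> j; rewrite -val_eqE /= => /negPf ->; rewrite andbF.
have kN1 : (k.+1 < N)%N by rewrite ltnS; exact: ltn_ord.
rewrite (sumE _ _ (ltnW kN1)) (sumE _ _ kN1).
rewrite -val_eqE /=; case: ltngtP => kk; last by rewrite kk subnn addr0.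
- by rewrite subnS -[in X in X + _](prednK (n := (k' - k)%N)) ?subn_gt0 // exprS mulN1r addNr.
- by rewrite addr0.
Qed.

Lemma ell_slmat b : ell (slmat b) = mon [:: (b, 0%N)].
Proof.
rewrite /ell (bigD1 b) //= coord_slmat eqxx scale1r big1 ?addr0 // => b' nb.
by rewrite coord_slmat eq_sym (negPf nb) scale0r.
Qed.

Lemma coordZ c X b : coord (c *: X) b = c * coord X b.
Proof.
have c0 : coord (0 : 'M[K]_N) b = 0.
  by have := coord_linear b (-1) X X; rewrite scaleN1r addNr mulN1r addNr.
by rewrite -[c *: X]addr0 coord_linear c0 addr0.
Qed.

Lemma coordD X Y b : coord (X + Y) b = coord X b + coord Y b.
Proof. by have := coord_linear b 1 X Y; rewrite scale1r mul1r. Qed.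

Lemma coord0 b : coord (0 : 'M[K]_N) b = 0.
Proof. by rewrite -(scale0r 0) coordZ mul0r. Qed.

Lemma str0 : str 0 = 0.
Proof. by rewrite -(scale0r 0) strZ mul0r. Qed.

Lemma str_slmat b : str (slmat b) = 0.
Proof.
case: b => [[[i j] ij]|k] /=.
  by rewrite str_delta; move: ij => /= /negPf ->; rewrite mul0r.
rewrite strD !str_delta !eqxx !mul1r /par /=.
by case: (odd k); rewrite /= ?expr0 ?expr1 (subrr, addNr).
Qed.

Lemma coord_eq0 X : (forall b, coord X b = 0) -> str X = 0 -> X = 0.
Proof.
move=> cX sX; apply/matrixP => i j; rewrite mxE.
have [<-{j}|ij] := eqVneq i j; last exact: (cX (inl (exist _ (i, j) ij))).
have XX m (mN : (m < N)%N) : (m < n.*2)%N -> X (Ordinal mN) (Ordinal mN) = 0.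
  elim/ltn_ind: m mN => m IH mN m2n; have := cX (inr (Ordinal m2n)).
  rewrite /= (bigD1 (Ordinal mN)) //= subnn mul1r big1 ?addr0 // => -[l lN].
  rewrite -val_eqE /= => /andP[lm ne]; have {lm ne}lm : (l < m)%N by rewrite ltn_neqAle ne.
  by rewrite IH ?mulr0 //; exact: ltn_trans m2n.
case: i => i iN; have [i2n|] := ltnP i n.*2; first exact: XX.
(* The last diagonal entry is invisible to the coordinates, but with all others zero it is the
   supertrace up to sign. *)
rewrite -ltnS => i2n; move: sX; rewrite /Defs.str (bigD1 (Ordinal iN)) //= big1 ?addr0.
  by move/eqP; rewrite mulf_eq0 signr_eq0 => /eqP.
move=> -[l lN]; rewrite -val_eqE /= => li; rewrite XX ?mulr0 //.
have lN' : (l < n.*2.+1)%N := lN; have iN' : (i < n.*2.+1)%N := iN.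
by move/eqP: li => li; lia.
Qed.

Lemma coordK X : str X = 0 -> \sum_b coord X b *: slmat b = X.
Proof.
move=> sX; apply/eqP; rewrite eq_sym -subr_eq0; apply/eqP; apply: coord_eq0 => [b|].
  rewrite coordD -scaleN1r coordZ.
  rewrite (big_morph (fun Y => coord Y b) (fun x y => coordD x y b) (coord0 b)).
  rewrite (bigD1 b) //= coordZ coord_slmat eqxx mulr1 big1 ?addr0 ?mulN1r ?subrr //.
  by move=> b' nb; rewrite coordZ coord_slmat (negPf nb) mulr0.
rewrite strD sX add0r -scaleN1r strZ (big_morph _ strD str0) big1 ?mulr0 //.
by move=> b _; rewrite strZ str_slmat mulr0.
Qed.

Notation bder := (@bder K (Bsl n) psl (@slbr K n) (@slform K n)).
Notation rho := (@rho K (Bsl n) psl (@nbas n) fcoef).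

Lemma bder0_ell a p X : mxpar p X -> str X = 0 ->
  bder a 0 (ell X) = (-1) ^+ (psl a && ~~ p) *:
    ell (slmat a *m X - (-1) ^+ (psl a && p) *: (X *m slmat a)).
Proof.
move=> hX sX; rewrite {1}/ell.
rewrite (big_morph _ (bderD (@slbr_par) (@slform_par) a 0) (bder0 (@slbr_par) (@slform_par) a 0)).
rewrite -[X in slmat a *m X](coordK sX) -[X in X *m slmat a](coordK sX).
rewrite mulmx_sumr mulmx_suml (scaler_sumr ((-1) ^+ (psl a && p))) -sumrB ell_sum scaler_sumr.
apply: eq_bigr => b _; rewrite (bderZ (@slbr_par) (@slform_par)).
have [->|nz] := eqVneq (coord X b) 0.
  by rewrite !scale0r mulmx0 mul0mx scaler0 subr0 raddf0 scaler0.
rewrite (bder_gen (@slbr_par) (@slform_par)) bdelta0 (coord_mxpar hX nz).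
rewrite -scalemxAr -scalemxAl scalerA mulrC -scalerA; congr (_ *: _).
rewrite [in RHS]scalerA [_ * coord X b]mulrC -[in RHS]scalerA -scalerBr ellZ.
congr (_ *: _); rewrite /slbr /ovl big_map big_enum /ell.
by apply: eq_bigr => b' _; rewrite (coord_mxpar hX nz).
Qed.

Lemma bder1_ell a X : str X = 0 -> bder a 1 (ell X) = str (slmat a *m X) *: 1.
Proof.
move=> sX; rewrite /ell.
rewrite (big_morph _ (bderD (@slbr_par) (@slform_par) a 1) (bder0 (@slbr_par) (@slform_par) a 1)).
rewrite -[X in slmat a *m X](coordK sX) mulmx_sumr (big_morph _ strD str0) scaler_suml.
apply: eq_bigr => b _; rewrite (bderZ (@slbr_par) (@slform_par)).
by rewrite (bder_gen (@slbr_par) (@slform_par)) bdelta0 -scalemxAr strZ scalerA.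
Qed.

Lemma bder2_ell a c X : bder a c.+2 (ell X) = 0.
Proof.
rewrite /ell.
rewrite (big_morph _ (bderD (@slbr_par) (@slform_par) a c.+2) (bder0 (@slbr_par) (@slform_par) a c.+2)).
rewrite big1 // => b _; rewrite (bderZ (@slbr_par) (@slform_par)).
by rewrite (bder_gen (@slbr_par) (@slform_par)) bdelta0 scaler0.
Qed.

(* str 1 = 1 makes this a projection of gl onto sl, the one inducing pi_sl. *)
Definition ppr X : 'M[K]_N := X - str X *: 1%:M.

Lemma ppr_linear : linear ppr.
Proof.
move=> c X Y; rewrite /ppr strD strZ scalerDl opprD addrACA scalerBr.
by rewrite scalerA.
Qed.

HB.instance Definition _ := GRing.isLinear.Build K 'M[K]_N 'M[K]_N _ ppr ppr_linear.

Lemma str_ppr X : str (ppr X) = 0.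
Proof. by rewrite /ppr -scaleNr strD strZ str1 mulr1 subrr. Qed.

Lemma ppr_id X : str X = 0 -> ppr X = X.
Proof. by move=> sX; rewrite /ppr sX scale0r subr0. Qed.

Lemma ppr1 : ppr 1%:M = 0.
Proof. by rewrite /ppr str1 scale1r subrr. Qed.

(** The image of $\bar e_{ij}$ under $\pi_{\mathfrak{sl}}$. *)
Definition eps i j : R := ell (ppr (delta_mx i j)).

Lemma ell_pprD X Y : ell (ppr (X + Y)) = ell (ppr X) + ell (ppr Y).
Proof.
have -> : ppr (X + Y) = ppr X + ppr Y by exact: raddfD.
exact: raddfD.
Qed.

Lemma mxpar_ppr_delta i j : mxpar (par i (+) par j) (ppr (delta_mx i j)).
Proof.
rewrite /ppr str_delta; apply: mxparD; first exact: mxpar_delta.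
have [<-|ij] := eqVneq i j; last by rewrite mul0r scale0r oppr0 => k l; rewrite mxE eqxx.
rewrite -scaleNr; apply: mxparZ => k l; rewrite mxE addbb.
by have [->|_] := eqVneq k l; rewrite ?addbb // eqxx.
Qed.

Lemma eps_homog i j : homog (~~ (par i (+) par j)) (eps i j).
Proof.
rewrite /eps /ell; apply: homog_sum => b _.
have [->|nz] := eqVneq (coord (ppr (delta_mx i j)) b) 0.
  by rewrite scale0r; exact: homog0.
apply: homogZ; have := homog_gen K psl (b, 0%N).
by rewrite /pg /= (coord_mxpar (@mxpar_ppr_delta i j) nz) addbF addbT.
Qed.

Lemma sum_eps : \sum_i eps i i = 0.
Proof.
rewrite /eps -ell_sum; have -> : \sum_i ppr (delta_mx i i) = ppr 1%:M.
  by rewrite [1%:M]mx1_sum_delta raddf_sum.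
by rewrite ppr1 raddf0.
Qed.

Lemma delta_mul i j k l :
  delta_mx i j *m delta_mx k l = (j == k)%:R *: delta_mx i l :> 'M[K]_N.
Proof.
have [<-|jk] := eqVneq j k; first by rewrite mul_delta_mx scale1r.
by rewrite mul_delta_mx_0 // scale0r.
Qed.

(** The multiple of the identity subtracted by [ppr] is central, and the commutator has supertrace
    zero, hence is fixed by [ppr]. So the [eps] bracket like the matrix units of gl. *)
Lemma bder0_eps k l i j (kl : k != l) :
  bder (inl (exist _ (k, l) kl)) 0 (eps i j) =
  (-1) ^+ ((par k (+) par l) && ~~ (par i (+) par j)) *:
    ((l == i)%:R *: eps k j -
     (-1) ^+ ((par k (+) par l) && (par i (+) par j)) *: ((j == k)%:R *: eps i l)).
Proof.
rewrite (bder0_ell _ (@mxpar_ppr_delta i j) (str_ppr _)) /=; congr (_ *: _).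
set s := (-1) ^+ _.
pose Z : 'M[K]_N := (l == i)%:R *: delta_mx k j - s *: ((j == k)%:R *: delta_mx i l).
have strZ0 : str Z = 0.
  rewrite /Z -scaleNr strD !strZ !str_delta.
  have [jk|jk] := eqVneq j k; last by rewrite !mul0r !mulr0 addr0.
  have [li|li] := eqVneq l i; last by rewrite !mul0r !mulr0 addr0.
  rewrite /s -li jk !mul1r; case: (par k) (par l) => -[];
    by rewrite /= ?expr0 ?expr1 ?mulN1r ?opprK ?mul1r ?subrr ?addNr.
have -> : delta_mx k l *m ppr (delta_mx i j) - s *: (ppr (delta_mx i j) *m delta_mx k l) = Z.
  rewrite /ppr str_delta mulmxBr mulmxBl !delta_mul -scalemxAr -scalemxAl mulmx1 mul1mx.
  rewrite scalerBr; set U := _ *: delta_mx k l; have -> : s *: U = U.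
    rewrite /U /s; have [->|_] := eqVneq i j; last by rewrite mul0r scale0r scaler0.
    by rewrite addbb andbF expr0 scale1r.
  by rewrite opprB addrA subrK.
rewrite -(ppr_id strZ0) /Z /eps.
have pprZ c Y : ppr (c *: Y) = c *: ppr Y by exact: linearZ.
have -> : ppr ((l == i)%:R *: delta_mx k j - s *: ((j == k)%:R *: delta_mx i l)) =
   (l == i)%:R *: ppr (delta_mx k j) - s *: ((j == k)%:R *: ppr (delta_mx i l)).
  by rewrite raddfB /= !pprZ.
by rewrite [LHS]raddfB /= !ellZ.
Qed.

Lemma bder1_eps k l i j (kl : k != l) :
  bder (inl (exist _ (k, l) kl)) 1 (eps i j) =
  ((l == i)%:R * (k == j)%:R * (-1) ^+ par k) *: 1.
Proof.
rewrite bder1_ell ?str_ppr //= /ppr mulmxBr delta_mul -scalemxAr mulmx1.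
rewrite -scaleNr strD !strZ !str_delta (negPf kl) mul0r mulr0 addr0.
by rewrite mulrA.
Qed.

Lemma bder2_eps a c i j : bder a c.+2 (eps i j) = 0.
Proof. exact: bder2_ell. Qed.

Lemma eps_offdiag i j (ij : i != j) : eps i j = mon [:: (inl (exist _ (i, j) ij), 0%N)].
Proof.
by rewrite -ell_slmat /eps ppr_id // str_delta (negPf ij) mul0r.
Qed.

(** Since $f e_{ij}=e_{i+1,j}$, the form $(f|e_{ij})$ for $i<j$ is nonzero only when $j=i+1$. *)
Lemma rho_eps i j : rho (eps i j) =
  if (j <= i)%N then eps i j
  else if j == i.+1 :> nat then (-1) ^+ par j *: 1 else 0.
Proof.
have [ji|ij] := leqP j i.
  rewrite /= /eps /ell (big_morph rho (rhoD _ (@fcoef_par)) (rho0 _ (@fcoef_par))); apply: eq_bigr => b _ /=; rewrite (rhoZ _ (@fcoef_par)).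
  have [->|nz] := eqVneq (coord (ppr (delta_mx i j)) b) 0; first by rewrite !scale0r.
  congr (_ *: _); rewrite (rho_gen _ (@fcoef_par)) /redgen /=; have [nb|//] := boolP (nbas b).
  case/eqP: nz; case: b nb => [[[i' j'] ij']|k] //= lt.
  rewrite !mxE; case: eqP => [ii|_] /=.
    case: eqP => [jj|_] /=; first by move: lt; rewrite ii jj ltnNge ji.
    by rewrite (negPf ij') mulr0 subr0.
  by rewrite (negPf ij') mulr0 subr0.
have ij' : i != j by rewrite -val_eqE neq_ltn ij.
rewrite (eps_offdiag ij') (rho_gen _ (@fcoef_par)) /redgen /= ij /fcoef /= /fmat.
rewrite mulmx_suml (big_morph _ strD str0).
have i2n : (i < n.*2)%N by rewrite -ltnS; apply: leq_trans (ltn_ord j); rewrite ltnS.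
rewrite (bigD1 i) //= delta_mul eqxx scale1r str_delta big1 ?addr0; last first.
  by move=> k /andP[_ ki]; rewrite delta_mul (negPf ki) scale0r str0.
have -> : (inord i.+1 == j :> 'I_n.*2.+1) = (j == i.+1 :> nat).
  by rewrite -val_eqE /= inordK ?ltnS // eq_sym.
rewrite /par; case: eqP => [->|_]; last by rewrite mul0r scale0r.
by rewrite mul1r inordK ?ltnS.
Qed.

End SpecialLinear.

(** * The operator rdet(A) *)

Section Operator.
Variables (K : numFieldType) (n : nat).
Notation N := (NN n).
Notation psl := (@psl n).
Notation R := (spoly K psl).
Notation D := (@D K (Bsl n) psl).
Notation spar := (@spar K (Bsl n) psl).
Notation eps := (@eps K n).
Implicit Types (X Y : {poly R}).

Definition oN (i : nat) : 'I_N := inord i.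

Lemma oN_val (i : nat) : (i < N)%N -> oN i = i :> nat.
Proof. exact: inordK. Qed.

Lemma oNK (i : 'I_N) : oN i = i.
Proof. exact: inord_val. Qed.

Lemma oN_eq (i : 'I_N) (j : nat) : (j < N)%N -> (i == oN j) = (i == j :> nat).
Proof. by move=> jN; rewrite -val_eqE /= (oN_val jN). Qed.

(** Left multiplication by $D$ on operators $\sum_m a_mD^m$, stored as polynomials with coefficients
    on the left: $D\,aD^m=D(a)D^m\pm aD^{m+1}$. The product of polynomials is not the product of
    operators. *)
Definition opDp X : {poly R} := map_poly D X + 'X * map_poly spar X.

Lemma coef_opDp X m :
  (opDp X)`_m = D X`_m + (if m is m'.+1 then spar X`_m' else 0).
Proof.
rewrite coefD coef_map coefXM; congr (_ + _).
by case: m => //= m; rewrite coef_map.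
Qed.

Lemma opDpD : {morph opDp : X Y / X + Y}.
Proof.
move=> X Y; apply/polyP => m; rewrite coefD !coef_opDp !coefD DD addrACA.
by congr (_ + _); case: m => [|m]; rewrite ?addr0 // coefD sparD.
Qed.

Lemma opDp0 : opDp 0 = 0.
Proof. by apply: (addrI (opDp 0)); rewrite -opDpD !addr0. Qed.

Lemma opDpN X : opDp (- X) = - opDp X.
Proof. by apply: (addrI (opDp X)); rewrite -opDpD !subrr opDp0. Qed.

(* The entries of A with the terms \delta_ij D removed. They are the values of [rho]
   on the full matrix of the (-1)^j \bar e_ji, which is what makes the brackets
   in [del0_symb] close up. *)
Definition symb (i j : nat) : R :=
  if (i <= j)%N then (-1) ^+ odd j *: eps (oN j) (oN i)
  else if i == j.+1 then -1 else 0.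

Definition amat (i j : nat) X : {poly R} :=
  (if i == j then opDp X else 0) + symb i j *: X.

Lemma amat_add : opadd amat.
Proof.
move=> i j X Y; rewrite /amat scalerDr addrACA; congr (_ + _).
by case: eqP => _; rewrite ?addr0 // opDpD.
Qed.

Lemma amat_hess : hessenberg amat.
Proof.
split=> [i j X ji|j X]; rewrite /amat /symb.
  rewrite leqNgt ltnW // gtn_eqF 1?ltnW //= gtn_eqF // scale0r addr0 //.
by rewrite gtn_eqF // ltnn eqxx scaleN1r add0r.
Qed.

(* The row determinant of the block of A with rows and columns >= o. The column
   P_j = pivot j.+1 satisfies A P = (rdet A, 0, ..., 0). *)
Definition pivot (o : nat) : {poly R} :=
  rowdet 1 (N - o) (fun i j : nat => amat (i + o)%N (j + o)%N).

Lemma pivotN : pivot N = 1.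
Proof. by rewrite /pivot subnn rowdet0. Qed.

Lemma pivot_rec o : (o < N)%N ->
  pivot o = \sum_(o <= j < N) amat o j (pivot j.+1).
Proof. exact: rowdet_hessenberg amat_add amat_hess. Qed.

Lemma pivot_ind (P : nat -> {poly R} -> Prop) : P N 1 ->
  (forall o, (o < N)%N -> (forall j : nat, (o <= j < N)%N -> P j.+1 (pivot j.+1)) -> P o (pivot o)) ->
  forall o, (o <= N)%N -> P o (pivot o).
Proof.
move=> P1 PS o; have [d] := ubnP (N - o); elim: d o => // d IH o od.
rewrite leq_eqVlt => /predU1P[->|oN']; first by rewrite pivotN.
apply: PS => // j /andP[oj jN]; apply: IH => //.
by apply: leq_trans (_ : N - o <= d)%N => //; apply: ltn_sub2l => //; rewrite ltnS.
Qed.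

(** Row [l] of $AP=(\mathrm{rdet}\,A,0,\dots,0)$. The subdiagonal entry contributes minus [pivot l],
    the remaining ones add up to [pivot l], and anything further left is 0, so the sum may start at
    any $k<l$. *)
Lemma sum_amat_below (k l : nat) : (k < l)%N -> (l < N)%N ->
  \sum_(k <= j < N) amat l j (pivot j.+1) = 0.
Proof.
move=> kl lN; have [a0 a1] := amat_hess.
case: l kl lN => // l kl lN.
rewrite (big_cat_nat (n := l)) //=; last by apply: ltnW; exact: ltnW.
rewrite big_nat big1 ?add0r; last by move=> j /andP[_ jl]; exact: a0.
rewrite big_ltn; last exact: ltnW.
by rewrite a1 -pivot_rec // addNr.
Qed.

Definition piw (w : word (Bgl n)) : R :=
  foldr *%R 1 [seq iter g.2 D (eps g.1.1 g.1.2) | g <- w].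

Definition piv (x : V K (Bgl n)) : R := \sum_(t <- x) t.1 *: piw t.2.

Lemma cls_pigen g : cls psl (@pigen K n g) = iter g.2 D (eps g.1.1 g.1.2).
Proof. exact: cls_ovl. Qed.

Lemma cls_piword w : cls psl (@piword K n w) = piw w.
Proof.
rewrite /piword /piw; elim: w => [|g w IH] //=.
by rewrite clsM IH cls_pigen.
Qed.

Lemma cls_pisl x : cls psl (pisl x) = piv x.
Proof.
rewrite /pisl cls_flatten; apply: eq_bigr => t _.
by rewrite clsZ cls_piword.
Qed.

Lemma iterD_homog m b x : homog b x -> homog (b (+) odd m) (iter m D x).
Proof.
move=> hx; elim: m => [|m IH] /=; first by rewrite addbF.
by rewrite addbN; exact: D_homog.
Qed.

Lemma piw_homog w : homog (pw (@pgl n) w) (piw w).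
Proof.
rewrite /piw /pw; elim: w => [|g w IH] /=; first exact: homog1.
apply: homogM => //; rewrite /pg addbT; apply: iterD_homog; exact: eps_homog.
Qed.

Lemma piv_Dword w : piv (Dword K (@pgl n) w) = D (piw w).
Proof.
rewrite /piw; elim: w => [|g w IH] /=; first by rewrite D1 /piv big_nil.
rewrite /piv big_cons scale1r DM -[foldr _ _ _]/(piw w) -IH; congr (_ + _).
have hg : homog (pg (@pgl n) g) (iter g.2 D (eps g.1.1 g.1.2)).
  by rewrite /pg addbT; apply: iterD_homog; exact: eps_homog.
rewrite big_map /= hg -scalerAl mulr_sumr scaler_sumr; apply: eq_bigr => t _.
by rewrite /= -scalerA -scalerAr.
Qed.

(** $\pi_{\mathfrak{sl}}$ applied to the coefficients of an operator. Working on formal sums avoids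
    building the quotient ring for gl. *)
Definition Phi (X : CV K (Bgl n)) : {poly R} :=
  \sum_(t <- X) (t.2.1 *: piw t.2.2) *: 'X^(t.1).

Lemma Phi_cat (X Y : CV K (Bgl n)) : Phi (X ++ Y) = Phi X + Phi Y.
Proof. exact: big_cat. Qed.

Lemma Phi_flatten I (r : seq I) (F : I -> CV K (Bgl n)) :
  Phi (flatten [seq F i | i <- r]) = \sum_(i <- r) Phi (F i).
Proof.
elim: r => [|i r IH] /=; first by rewrite /Phi !big_nil.
by rewrite Phi_cat IH big_cons.
Qed.

Lemma Phi_sign (b : bool) (X : CV K (Bgl n)) : Phi (cscale ((-1) ^+ b) X) = (-1) ^+ b *: Phi X.
Proof.
rewrite /Phi big_map scaler_sumr; apply: eq_bigr => t _ /=.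
rewrite scalerA -scalerA; congr (_ *: _).
by case: b; rewrite ?scale1r ?mul1r // expr1 scaleN1r expr1 mulN1r.
Qed.

Lemma Phi_const (k : nat) x : Phi [seq (k, u) | u <- x] = piv x *: 'X^k.
Proof. by rewrite /Phi /piv big_map scaler_suml. Qed.

Lemma Phi_opD (X : CV K (Bgl n)) : Phi (opD (@pgl n) X) = opDp (Phi X).
Proof.
rewrite /opD Phi_flatten [Phi X]/Phi (big_morph _ opDpD opDp0).
apply: eq_bigr => -[k [c w]] _ /=; rewrite Phi_cat Phi_const.
have -> : piv (vscale c (Dword K (@pgl n) w)) = D (c *: piw w).
  rewrite DZ -piv_Dword /piv big_map scaler_sumr.
  by apply: eq_bigr => t _; rewrite scalerA.
rewrite /Phi big_seq1 /= -scalerA; apply/polyP => m.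
rewrite coefD coef_opDp !coefZ !coefXn.
congr (_ + _); first by case: eqP => _; rewrite ?mulr1 ?mulr0 ?D0.
case: m => [|m]; rewrite ?mulr0 //= eqSS coefZ coefXn.
case: eqP => _; rewrite ?mulr1 ?mulr0 ?raddf0 //.
by rewrite sparZ piw_homog !scalerA mulrC.
Qed.

Lemma Phi_iter_opD m (X : CV K (Bgl n)) : Phi (iter m (opD (@pgl n)) X) = iter m opDp (Phi X).
Proof. by elim: m => //= m IH; rewrite Phi_opD IH. Qed.

Lemma piw_cat u v : piw (u ++ v) = piw u * piw v.
Proof. by rewrite /piw; elim: u => [|g u IH] /=; rewrite ?mul1r // IH mulrA. Qed.

Lemma Phi_opmul (X Y : CV K (Bgl n)) : Phi (opmul (@pgl n) X Y) =
  \sum_(t <- X) (t.2.1 *: piw t.2.2) *: iter t.1 opDp (Phi Y).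
Proof.
rewrite /opmul Phi_flatten; apply: eq_bigr => -[k [c w]] _ /=.
rewrite -Phi_iter_opD /Phi big_map scaler_sumr; apply: eq_bigr => -[k' [c' w']] _ /=.
by rewrite piw_cat scalerA -scalerAl -scalerAr scalerA.
Qed.

Lemma Phi_Amat (i j : 'I_N) (Y : CV K (Bgl n)) : Phi (opmul (@pgl n) (Amat K i j) Y) = amat i j (Phi Y).
Proof.
rewrite Phi_opmul /amat /symb /Amat; case: leqP => ij.
  rewrite big_cat /= big_seq1 /= !oNK; congr (_ + _).
    by rewrite val_eqE; case: eqP => _; rewrite ?big_nil // big_seq1 /= !scale1r.
  by rewrite /piw /= mulr1.
rewrite (gtn_eqF ij) add0r; case: eqP => _; last by rewrite big_nil scale0r.
by rewrite big_seq1 /= scaleN1r.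
Qed.

Lemma Phi_rdet : Phi (rdet K n) = pivot 0.
Proof.
rewrite /rdet Phi_flatten big_enum /= /pivot subn0 /rowdet.
apply: eq_bigr => s _; rewrite Phi_sign; congr (_ *: _).
elim: (enum 'I_N) => [|i l IH] /=.
  by rewrite /Phi big_seq1 /= !scale1r.
by rewrite Phi_Amat IH !addn0.
Qed.

Lemma cls_wcoef k : cls psl (pisl (wcoef K n k)) = (pivot 0)`_(N - k).
Proof.
rewrite -Phi_rdet cls_pisl /Phi coef_sum /piv /wcoef big_map big_filter big_mkcond.
apply: eq_bigr => t _; rewrite coefZ coefXn eq_sym.
by case: eqP => _; rewrite ?mulr1 ?mulr0.
Qed.

End Operator.

(** * Invariance of the coefficients of rdet(A) *)

Section Invariance.
Variables (K : numFieldType) (n : nat).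
Notation N := (NN n).
Notation psl := (@psl n).
Notation R := (spoly K psl).
Notation D := (@D K (Bsl n) psl).
Notation spow := (@spow K (Bsl n) psl).
Notation spar := (@spar K (Bsl n) psl).
Notation eps := (@eps K n).
Notation rho := (@rho K (Bsl n) psl (@nbas n) (@fcoef K n)).
Notation del := (@rder K (Bsl n) psl (@nbas n) (@fcoef K n) (@slbr K n) (@slform K n)).
Notation symb := (@symb K n).
Notation amat := (@amat K n).
Notation pivot := (@pivot K n).
Notation opDp := (@opDp K n).
Notation oN := (oN n).
Implicit Types (X Y : {poly R}).

Lemma slrhoD x y : rho (x + y) = rho x + rho y. Proof. exact: rhoD (@fcoef_par K n) x y. Qed.
Lemma slrhoZ c x : rho (c *: x) = c *: rho x. Proof. exact: rhoZ (@fcoef_par K n) c x. Qed.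
Lemma slrhoM x y : rho (x * y) = rho x * rho y. Proof. exact: rhoM (@fcoef_par K n) x y. Qed.
Lemma slrho_D x : rho (D x) = D (rho x). Proof. exact: rho_D (@fcoef_par K n) x. Qed.

Lemma slrho0 : rho 0 = 0. Proof. exact: rho0 (@fcoef_par K n). Qed.
Lemma slrho1 : rho 1 = 1. Proof. exact: rho1 (@fcoef_par K n). Qed.

Section BracketCoefficients.
Variable a : Bsl n.
Let lbp := @slbr_par K n.
Let fmp := @slform_par K n.
Let fcp := @fcoef_par K n.

Lemma delD c : {morph del a c : x y / x + y}. Proof. by move=> x y; exact: rderD. Qed.
Lemma delZ c k x : del a c (k *: x) = k *: del a c x. Proof. exact: rderZ. Qed.
Lemma del0 c : del a c 0 = 0. Proof. exact: rder0. Qed.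
Lemma del1 c : del a c 1 = 0. Proof. exact: rder1. Qed.
Lemma delM c x y : del a c (x * y) =
  del a c x * rho y + spow (psl a (+) odd c) (rho x) * del a c y.
Proof. exact: rderM. Qed.
Lemma del_D c x : del a c (D x) = (-1) ^+ (psl a (+) odd c) *:
  (D (del a c x) - prevc (fun c' => del a c' x) c).
Proof. exact: rder_D. Qed.
Lemma del_spar c x :
  del a c (spar x) = (-1) ^+ (psl a (+) odd c) *: spar (del a c x).
Proof. exact: spar_rder. Qed.

Definition dp c X : {poly R} := \poly_(m < size X) del a c X`_m.

Lemma coef_dp c X m : (dp c X)`_m = del a c X`_m.
Proof.
rewrite coef_poly; case: ltnP => // sm.
by rewrite nth_default // del0.
Qed.

Lemma dpD c : {morph dp c : X Y / X + Y}.
Proof. by move=> X Y; apply/polyP => m; rewrite coefD !coef_dp coefD delD. Qed.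

Lemma dp0 c : dp c 0 = 0.
Proof. by apply/polyP => m; rewrite coef_dp !coef0 del0. Qed.

Lemma dp1 c : dp c 1 = 0.
Proof. by apply/polyP => m; rewrite coef_dp !coef1 coef0; case: m => [|m]; rewrite ?del0 ?del1. Qed.

Lemma sign_scale (b : bool) (x : R) : (-1) ^+ b * x = (-1) ^+ b *: x.
Proof. by case: b; rewrite ?mul1r ?scale1r // !expr1 mulN1r scaleN1r. Qed.

Definition prevp (F : nat -> {poly R}) (c : nat) := if c is c'.+1 then F c' else 0.

(** Both terms of [opDp] pass the derivation with the same sign, so sesquilinearity extends from
    coefficients to operators. *)
Lemma dp_opDp c X : dp c (opDp X) = (-1) ^+ (psl a (+) odd c) *:
  (opDp (dp c X) - prevp (fun c' => dp c' X) c).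
Proof.
apply/polyP => m; rewrite coefZ coef_dp coefB !coef_opDp coef_dp delD del_D.
have -> : del a c (if m is m'.+1 then spar X`_m' else 0) =
    (-1) ^+ (psl a (+) odd c) *: (if m is m'.+1 then spar (dp c X)`_m' else 0).
  by case: m => [|m]; rewrite ?del0 ?scaler0 // del_spar coef_dp.
have -> : prevc (fun c' => del a c' X`_m) c = (prevp (fun c' => dp c' X) c)`_m.
  by case: c => [|c] /=; rewrite ?coef0 // coef_dp.
by rewrite sign_scale -scalerDr addrAC.
Qed.

Definition fixedp X := forall m, rho X`_m = X`_m.

Lemma dp_scale c x X : rho x = x -> fixedp X ->
  dp c (x *: X) = del a c x *: X + spow (psl a (+) odd c) x *: dp c X.
Proof.
move=> hx hX; apply/polyP => m.
by rewrite coefD !coefZ !coef_dp coefZ delM hx hX.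
Qed.

End BracketCoefficients.

Section Strict.
Variables (k l : 'I_N) (kl : k != l).
Notation a := (inl (exist _ (k, l) kl) : Bsl n).

Lemma rho_eps_symb (i : nat) (j : 'I_N) : (i < N)%N ->
  rho (eps j (oN i)) = (-1) ^+ par j *: symb i j.
Proof.
move=> iN; rewrite rho_eps (oN_val iN) /symb oNK; case: leqP => ij.
  by rewrite scalerA -signr_addb addbb scale1r.
case: eqP => [ij'|_]; last by rewrite scaler0.
by rewrite /par (oN_val iN) ij' /= signrN scaleNr scalerN.
Qed.

(** Entry $(i,j)$ of a twisted commutator with the elementary matrix $E_{kl}$: the first term comes
    from $AE_{kl}$, the second from $E_{kl}A$. *)
Lemma del0_symb (i j : nat) : (i <= j < N)%N ->
  del a 0 (symb i j) =
    (l == j :> nat)%:R *: ((-1) ^+ ((odd k (+) odd l) && (odd i (+) odd l)) *: symb i k)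
    - (k == i :> nat)%:R *: ((-1) ^+ (odd k (+) odd l) *: symb l j).
Proof.
case/andP=> ij jN; have iN : (i < N)%N := leq_ltn_trans ij jN.
rewrite {1}/symb ij delZ /rder bder0_eps (oN_eq _ jN) (eq_sym (oN i)) (oN_eq _ iN).
rewrite slrhoZ -scaleNr slrhoD !slrhoZ (rho_eps_symb _ iN).
rewrite -[X in eps _ X]oNK (rho_eps_symb _ (ltn_ord l)) /par (oN_val iN) (oN_val jN).
rewrite scalerDr scalerDr; congr (_ + _).
  rewrite !scalerA; have [<-|_] := eqVneq (nat_of_ord l) j; last by rewrite !(mulr0, mul0r).
  rewrite !mulr1 mul1r; congr (_ *: _).
  by rewrite -!signr_addb; congr ((-1) ^+ nat_of_bool _); case: (odd k) (odd l) (odd i) => -[] [].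
rewrite !scalerA -scalerN !scalerA; congr (_ *: _).
have [_|_] := eqVneq (nat_of_ord k) i; last by rewrite !(mulr0, mul0r, oppr0).
rewrite !(mulr1, mul1r, mulrN, mulNr); congr (- _).
rewrite -!signr_addb; congr ((-1) ^+ nat_of_bool _).
by case: (odd k) (odd l) (odd i) (odd j) => -[] [] [].
Qed.

Lemma delS_symb (c i j : nat) : (i <= j < N)%N ->
  del a c.+1 (symb i j) =
    if [&& c == 0%N, l == j :> nat & k == i :> nat] then (-1) ^+ (odd k (+) odd l) *: 1 else 0.
Proof.
case/andP=> ij jN; have iN : (i < N)%N := leq_ltn_trans ij jN.
rewrite /symb ij delZ /rder; case: c => [|c]; last by rewrite bder2_eps slrho0 scaler0.
rewrite bder1_eps (oN_eq _ jN) (oN_eq _ iN) slrhoZ slrho1 scalerA /par.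
have [<-|_] := eqVneq (nat_of_ord l) j; last by rewrite /= !(mulr0, mul0r) scale0r.
have [_|_] := eqVneq (nat_of_ord k) i; last by rewrite /= !(mulr0, mul0r) scale0r.
by rewrite !mul1r signr_addb mulrC.
Qed.

End Strict.

(* The generators D^m \bar e_ji, i <= j, lying in columns i >= o of lower
   triangular matrices. *)
Definition lowcol (o : nat) (x : R) : Prop := exists (i j m : nat),
  (o <= i)%N /\ (i <= j < N)%N /\ x = iter m D (eps (oN j) (oN i)).

Lemma lowcol_homog o : homogenous (lowcol o).
Proof.
move=> _ [i [j [m [_ [_ ->]]]]].
by exists (~~ (par (oN j) (+) par (oN i)) (+) odd m); exact/iterD_homog/eps_homog.
Qed.

Lemma lowcol_D o x : lowcol o x -> alg (lowcol o) (D x).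
Proof.
by move=> [i [j [m [oi [ijN ->]]]]]; apply: alg_gen; exists i, j, m.+1.
Qed.

Lemma lowcol_fixed o x : lowcol o x -> rho x = x.
Proof.
move=> [i [j [m [oi [/andP[ij jN] ->]]]]].
elim: m => [|m IH] /=; last by rewrite slrho_D IH.
by rewrite rho_eps !oN_val ?ij //; exact: leq_ltn_trans jN.
Qed.

Lemma lowcolW o o' x : (o <= o')%N -> lowcol o' x -> lowcol o x.
Proof.
by move=> oo [i [j [m [oi H]]]]; exists i, j, m; split=> //; exact: leq_trans oi.
Qed.

Lemma symb_alg (o j : nat) : (o <= j < N)%N -> alg (lowcol o) (symb o j).
Proof.
move=> ojN; have /andP[oj _] := ojN; rewrite /symb oj; apply/alg_scale/alg_gen.
by exists o, j, 0%N.
Qed.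

Lemma pivot_alg o : (o <= N)%N -> forall m, alg (lowcol o) (pivot o)`_m.
Proof.
move: o; apply: (pivot_ind (P := fun o X => forall m, alg (lowcol o) X`_m)).
  by move=> m; rewrite coef1 -scaler_nat; exact: alg_scalar.
move=> o oN' IH m; rewrite pivot_rec // coef_sum big_nat; apply: alg_sum => j oj.
have IHj m' : alg (lowcol o) (pivot j.+1)`_m'.
  have H : alg (lowcol j.+1) (pivot j.+1)`_m' := IH j oj m'.
  apply: alg_sub H => z zl. apply/alg_gen; apply: lowcolW zl.
  by case/andP: oj => oj _; exact: leqW.
rewrite coefD; apply: alg_add.
  case: eqP => _; last by rewrite coef0; exact: alg0.
  rewrite coef_opDp; apply: alg_add.
    by apply: alg_D => //; [exact: lowcol_homog|exact: lowcol_D].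
  case: m => [|m]; first exact: alg0.
  exact: (alg_spow true (@lowcol_homog o)).
by rewrite coefZ; apply: alg_mul => //; exact: symb_alg.
Qed.

Lemma pivot_fixed o : (o <= N)%N -> fixedp (pivot o).
Proof.
move=> oN' m; exact (alg_rho (@fcoef_par K n) (@lowcol_fixed o) (pivot_alg oN' m)).
Qed.

(** [pivot o] is monic of degree $N-o$: one $D$ is gained from the diagonal entry, while entries to
    its right multiply pivots of lower degree. *)
Lemma pivot_top o : (o <= N)%N ->
  forall m, (N - o <= m)%N -> (pivot o)`_m = (m == (N - o)%N)%:R.
Proof.
move: o; apply: (pivot_ind (P := fun o X => forall m, (N - o <= m)%N -> X`_m = (m == (N - o)%N)%:R)).
  by move=> m _; rewrite coef1 subnn.
move=> o oN' IH m om; rewrite pivot_rec // coef_sum big_ltn // big_nat big1 ?addr0.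
  rewrite /amat eqxx coefD coefZ coef_opDp.
  have oo : (o <= o < N)%N by rewrite leqnn.
  have NE : (N - o = (N - o.+1).+1)%N by rewrite subnSK.
  case: m om => [|m]; first by rewrite NE.
  rewrite NE ltnS eqSS => om.
  rewrite (IH o oo m.+1) ?(leqW om) // gtn_eqF ?ltnS // mulr0 addr0 D0 add0r IH //.
  by case: eqP => _; rewrite ?spar1 ?raddf0.
move=> j /andP[oj jN]; rewrite /amat (ltn_eqF oj) add0r coefZ.
have Nj : (N - j.+1 < m)%N.
  by apply: leq_trans om; apply: ltn_sub2l => //; rewrite ltnS ltnW.
rewrite IH; last exact: ltnW.
  by rewrite gtn_eqF // mulr0.
by rewrite jN ltnW.
Qed.

(* Modulo J, {\bar e_kl _chi A} = sigma(A) E_kl - (-1)^(k+l) E_kl A, where sigma is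
   the twist of the derivation. Applied to A P = (rdet A) e_0 this shows that the
   bracket of P is -E_kl P and that the bracket of rdet A vanishes. *)
Lemma dp_pivot (k l : 'I_N) (klt : (k < l)%N) (kl : k != l) (o : nat) : (o <= N)%N ->
  forall c, dp (inl (exist _ (k, l) kl)) c (pivot o) =
    if (c == 0%N) && (o == k.+1) then - pivot l.+1 else 0.
Proof.
set a := inl _; pose pa := odd k (+) odd l; have paE : psl a = pa by [].
move: o; apply: (pivot_ind (P := fun o X => forall c, dp a c X =
    if (c == 0%N) && (o == k.+1) then - pivot l.+1 else 0)).
  move=> c; rewrite dp1; case: eqP => //= _; rewrite gtn_eqF //; exact: leq_ltn_trans klt (ltn_ord l).
move=> o oN' IH c; rewrite pivot_rec // (big_morph _ (dpD a c) (dp0 a c)).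
pose s : R := (-1) ^+ (psl a (+) odd c).
have E (j : nat) : (o <= j < N)%N -> dp a c (amat o j (pivot j.+1)) =
    (if o == j then s *: (opDp (dp a c (pivot j.+1)) - prevp (fun c' => dp a c' (pivot j.+1)) c) else 0)
    + del a c (symb o j) *: pivot j.+1
    + spow (psl a (+) odd c) (symb o j) *: dp a c (pivot j.+1).
  move=> oj; have /andP[_ jN] := oj; rewrite /amat dpD dp_scale.
  - rewrite addrA; congr (_ + _ + _); case: eqP => _; last by rewrite dp0.
    by rewrite dp_opDp.
  - exact (alg_rho (@fcoef_par K n) (@lowcol_fixed o) (symb_alg oj)).
  - exact: pivot_fixed.
rewrite big_nat (eq_bigr _ E) -big_nat !big_split /=.
pose H := pivot l.+1.
have sum1 (F : nat -> {poly R}) (i : nat) : \sum_(o <= j < N) (if i == j then F j else 0) =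
    if (o <= i < N)%N then F i else 0.
  rewrite -big_mkcond -(big_nat1_eq +%R F i); apply: eq_bigl => j; exact: eq_sym.
have oo : (o <= o < N)%N by rewrite leqnn.
rewrite (sum1 (fun j => s *: (opDp (dp a c (pivot j.+1)) - prevp (fun c' => dp a c' (pivot j.+1)) c))) oo.
rewrite (IH o oo) eqSS.
have third (b : bool) : \sum_(o <= j < N) spow b (symb o j) *: dp a c (pivot j.+1) =
    if (c == 0%N) && (o <= k)%N then - (spow b (symb o k) *: H) else 0.
  transitivity (\sum_(o <= j < N) (if k == j :> nat then
     (if c == 0%N then - (spow b (symb o j) *: H) else 0) else 0)).
    rewrite [LHS]big_nat [RHS]big_nat; apply: eq_bigr => j oj; rewrite (IH j oj) eqSS [j == k]eq_sym.
    by case: eqP => _ /=; case: eqP => _ //=; rewrite ?scalerN ?scaler0.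
  rewrite (sum1 (fun j => if c == 0%N then - (spow b (symb o j) *: H) else 0)).
  by rewrite ltn_ord andbT; case: (c == 0%N); case: (o <= k)%N.
rewrite third {third E}.
case: c @s => [|c] s; rewrite /=; last first.
  rewrite addr0; case: c @s => [|c] s /=; last first.
    rewrite big_nat big1 ?addr0.
      by rewrite /= IH //= opDp0 subr0 scaler0.
    by move=> j oj; rewrite (delS_symb kl _ oj) /= scale0r.
  (* Coefficient of $\chi$: in row $k$ the diagonal $D$ meets the bracket of $P_k$ and produces a
     $\chi$-term, which cancels the form contribution of the entry $(k,l)$. *)
  rewrite (IH o oo) /= eqSS opDp0 sub0r.
  transitivity (s *: - (if o == k then - H else 0)
     + \sum_(o <= j < N) (if l == j :> nat then if k == o :> nat then (-1) ^+ pa *: pivot j.+1 else 0 else 0)).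
    congr (_ + _); rewrite [LHS]big_nat [RHS]big_nat; apply: eq_bigr => j oj.
    rewrite (delS_symb kl _ oj) /=; case: eqP => _ /=; last by rewrite scale0r.
    case: eqP => _ /=; last by rewrite scale0r.
    by rewrite -sign_scale mulr1.
  rewrite (sum1 (fun j => if k == o :> nat then (-1) ^+ pa *: pivot j.+1 else 0)).
  rewrite ltn_ord andbT eq_sym; case: eqP => [ko|_]; last by rewrite oppr0 scaler0 add0r if_same.
  by rewrite -ko ltnW // opprK /s paE addbT signrN scaleNr addNr.
have -> : \sum_(o <= j < N) del a 0 (symb o j) *: pivot j.+1 =
   (if (o <= l)%N then ((-1) ^+ (pa && (odd o (+) odd l)) *: symb o k) *: H else 0)
   - (if k == o :> nat then (-1) ^+ pa *: \sum_(o <= j < N) symb l j *: pivot j.+1 else 0).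
  transitivity (\sum_(o <= j < N) (if l == j :> nat then
         ((-1) ^+ (pa && (odd o (+) odd l)) *: symb o k) *: pivot j.+1 else 0)
     - \sum_(o <= j < N) (if k == o :> nat then (-1) ^+ pa *: (symb l j *: pivot j.+1) else 0)).
    rewrite -sumrB [LHS]big_nat [RHS]big_nat; apply: eq_bigr => j oj.
    rewrite (del0_symb kl oj) scalerBl; congr (_ - _).
      by case: eqP => _; rewrite ?scale1r // !scale0r.
    by case: eqP => _; rewrite ?scale1r ?scale0r // scalerA sign_scale.
  rewrite (sum1 (fun j => ((-1) ^+ (pa && (odd o (+) odd l)) *: symb o k) *: pivot j.+1)).
  rewrite ltn_ord andbT; congr (_ - _); case: eqP => _; first by rewrite scaler_sumr.
  by rewrite big1.
rewrite subr0 addbF.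
(* In rows $o\le k$ the $AE_{kl}$ part of the commutator, acting on $P_l$, cancels against the entry
   $(o,k)$ times the bracket $-P_l$ of $P_k$. *)
have canc : (o <= k)%N -> ((-1) ^+ (pa && (odd o (+) odd l)) *: symb o k) *: H
    + - (spow (par k (+) par l) (symb o k) *: H) = 0.
  move=> ok; rewrite -scalerBl [X in X *: H](_ : _ = 0) ?scale0r //.
  rewrite /symb ok spowZ (homog_spow _ (@eps_homog K n (oN k) (oN o))) /par (oN_val oN') oNK.
  rewrite scalerA -signr_addb scalerA -signr_addb; apply/eqP; rewrite subr_eq0; apply/eqP.
  congr ((-1) ^+ nat_of_bool _ *: _).
  by rewrite /pa; case: (odd k) (odd l) (odd o) => -[] [].
have [ok|ko|okE] := ltngtP o k.
- have ol : (o <= l)%N by apply: ltnW; exact: ltn_trans klt.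
  rewrite ol /= opDp0 scaler0 add0r subr0 canc ?(ltnW ok) //.
  by rewrite (ltn_eqF (leqW ok)).
- rewrite opDp0 scaler0 add0r subr0 addr0.
  (* Here the sum no longer contains column $k$, so nothing cancels the $AE_{kl}$ part; its
     coefficient is the subdiagonal $-1$. *)
  have [->|ne] := eqVneq o k.+1.
    rewrite klt /symb ltnn eqxx /= /pa; case: (odd k) (odd l) => -[] /=;
    by rewrite ?scale1r scaleN1r.
  rewrite /symb (leqNgt o k) ko (negPf ne) scaler0 scale0r; by case: ifP.
have ol : (o <= l)%N by rewrite okE ltnW.
have -> : (o == k.+1) = false by rewrite okE ltn_eqF.
rewrite ol addrCA addrAC canc ?okE // add0r.
(* In row $k$ the remaining terms form, up to sign, row $l$ of $AP$, which is 0. *)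
have := @sum_amat_below K n k l klt (ltn_ord l); rewrite big_split /= -okE.
rewrite (sum1 (fun j => opDp (pivot j.+1))) ol ltn_ord => /eqP.
rewrite addr_eq0 => /eqP E; rewrite opDpN E opprK /s paE addbF.
by case: (pa); rewrite ?scale1r ?subrr // !expr1 !scaleN1r opprK addNr.
Qed.

End Invariance.

(** * Generators of V(p-bar) *)

Section Generators.
Variables (K : numFieldType) (n : nat).
Notation N := (NN n).
Notation psl := (@psl n).
Notation R := (spoly K psl).
Notation mon := (@mon K (Bsl n) psl).
Notation D := (@D K (Bsl n) psl).
Notation eps := (@eps K n).
Notation rho := (@rho K (Bsl n) psl (@nbas n) (@fcoef K n)).
Notation del := (@rder K (Bsl n) psl (@nbas n) (@fcoef K n) (@slbr K n) (@slform K n)).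
Notation symb := (@symb K n).
Notation amat := (@amat K n).
Notation pivot := (@pivot K n).
Notation oN := (oN n).
Notation lowcol := (@lowcol K n).

Definition wgen (x : R) : Prop := exists i m : nat,
  (2 <= i <= N)%N /\ x = iter m D (pivot 0)`_(N - i).

Lemma pivot_homog o : (o <= N)%N ->
  forall m, homog (odd (N - o) (+) odd m) (pivot o)`_m.
Proof.
move: o; apply: (pivot_ind (P := fun o X => forall m, homog (odd (N - o) (+) odd m) X`_m)).
  move=> m; rewrite coef1 subnn; case: m => [|m]; [exact: homog1|exact: homog0].
move=> o oN' IH m; rewrite pivot_rec // coef_sum big_nat; apply: homog_sum => j oj.
have /andP[oj' jN] := oj; rewrite coefD; apply: homogD.
  case: eqP => [oE|_]; last by rewrite coef0; exact: homog0.
  have NE : odd (N - o) = ~~ odd (N - j.+1).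
    by rewrite -oE -(subnSK oN').
  rewrite coef_opDp NE addNb; apply: homogD; first by apply: D_homog; exact: IH.
  case: m => [|m]; first exact: homog0.
  have := IH j oj m; rewrite /= addbN negbK => h.
  by rewrite /homog sparK h scalerA -signr_addb addbb scale1r.
rewrite coefZ /symb oj'.
have -> : odd (N - o) (+) odd m = (~~ (odd j (+) odd o)) (+) (odd (N - j.+1) (+) odd m).
  have E : (N - o = (N - j.+1) + (j - o).+1)%N by lia.
  rewrite E oddD /= (oddB oj'); by case: (odd j) (odd o) (odd m) (odd (N - _)) => -[] [] [].
apply: homogM; last exact: IH.
by apply: homogZ; have := @eps_homog K n (oN j) (oN o); rewrite /par !oN_val.
Qed.

Lemma wgen_homog : homogenous wgen.
Proof.
move=> _ [i [m [_ ->]]]; eexists; apply: iterD_homog; exact: pivot_homog.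
Qed.

Lemma wgen_fixed x : wgen x -> rho x = x.
Proof.
move=> [i [m [_ ->]]]; elim: m => [|m IH] /=; last by rewrite slrho_D IH.
exact: pivot_fixed.
Qed.

Lemma nbas_strict a : nbas a ->
  exists (k l : 'I_N) (kl : k != l), (k < l)%N /\ a = inl (exist _ (k, l) kl).
Proof. by case: a => // -[[k l] kl] klt; exists k, l, kl. Qed.

(** The operator rdet(A) is [pivot 0], and 0 is not of the exceptional form [k.+1] in [dp_pivot];
    derivatives follow by sesquilinearity. *)
Lemma wgen_invariant x a c : wgen x -> nbas a -> del a c x = 0.
Proof.
move=> [i [m [_ ->]]] /nbas_strict[k [l [kl [klt ->]]]].
elim: m c => [|m IH] c /=.
  by rewrite -coef_dp (@dp_pivot K n k l klt) ?leq0n // andbF coef0.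
by rewrite del_D IH D0; case: c => [|c] /=; rewrite ?IH subr0 scaler0.
Qed.

(* A triple (i, j, m) encodes the generator D^m \bar e_ji, up to sign. Column 0 is
   excluded: its entries are traded for the coefficients of rdet(A). *)
Definition valid (t : nat * nat * nat) : bool := (0 < t.1.1)%N && (t.1.1 <= t.1.2 < N)%N.
Definition yv (t : nat * nat * nat) : R := iter t.2 D (symb t.1.1 t.1.2).

Definition ygen (x : R) : Prop := wgen x \/ exists t, valid t /\ x = yv t.

Lemma symb_homog (i j : nat) : (i <= j < N)%N -> homog (~~ (odd j (+) odd i)) (symb i j).
Proof.
case/andP=> ij jN; rewrite /symb ij; apply: homogZ.
by have := @eps_homog K n (oN j) (oN i); rewrite /par !oN_val //; exact: leq_ltn_trans jN.
Qed.

Lemma symb_fixed (i j : nat) : (i <= j < N)%N -> rho (symb i j) = symb i j.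
Proof.
move=> ijN; exact (alg_rho (@fcoef_par K n) (@lowcol_fixed K n i) (symb_alg K ijN)).
Qed.

Lemma yv_homog t : valid t -> homog (~~ (odd t.1.2 (+) odd t.1.1) (+) odd t.2) (yv t).
Proof. by case/andP=> _ v; apply/iterD_homog/symb_homog. Qed.

Lemma yv_fixed t : valid t -> rho (yv t) = yv t.
Proof.
case/andP=> _ v; rewrite /yv; elim: t.2 => [|m IH] /=; last by rewrite slrho_D IH.
exact: symb_fixed.
Qed.

Lemma ygen_homog : homogenous ygen.
Proof.
move=> x [/wgen_homog //|[t [v ->]]]; eexists; exact: yv_homog.
Qed.

Lemma ygen_D x : ygen x -> alg ygen (D x).
Proof.
move=> [[i [m [im ->]]]|[[ij m] [v ->]]]; apply: alg_gen.
  by left; exists i, m.+1.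
by right; exists (ij, m.+1).
Qed.

Lemma alg_iterD m x : alg ygen x -> alg ygen (iter m D x).
Proof.
by move=> ax; elim: m => //= m IH; apply: alg_D => //; [exact: ygen_homog|exact: ygen_D].
Qed.

Lemma lowcol_ygen o x : (0 < o)%N -> alg (lowcol o) x -> alg ygen x.
Proof.
move=> o0; apply: alg_sub => _ [i [j [m [oi [/andP[ij jN] ->]]]]].
apply: alg_iterD; have -> : eps (oN j) (oN i) = (-1) ^+ odd j *: symb i j.
  by rewrite /symb ij scalerA -signr_addb addbb scale1r.
apply/alg_scale/alg_gen; right; exists (i, j, 0%N); split=> //.
by rewrite /valid /= (leq_trans o0 oi) ij.
Qed.

Lemma eps_ygen (i j : nat) : (i <= j < N)%N -> alg ygen (eps (oN j) (oN i)).
Proof.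
have pos (i' j' : nat) : (0 < i')%N -> (i' <= j' < N)%N -> alg ygen (eps (oN j') (oN i')).
  move=> i0 ij; apply: (@lowcol_ygen i') => //; apply: alg_gen.
  by exists i', j', 0%N.
case: i => [|i]; last exact: pos.
elim/ltn_ind: j => j IH /= jN.
case: j => [|j] in IH jN *.
  have := @sum_eps K n; rewrite (bigD1 ord0) //= => /eqP; rewrite addr_eq0 => /eqP E.
  have -> : oN 0 = ord0 by apply/val_inj; rewrite /= oN_val.
  rewrite E; apply/alg_opp/alg_sum => i i0; rewrite -(oNK i); apply: pos.
    by rewrite lt0n.
  by rewrite leqnn ltn_ord.
(* The degree of the monic operator [pivot j.+2] that multiplies the entry $(0,j+1)$. At this degree
   earlier columns contribute known entries, and later columns nothing, their pivots having smaller
   degree. *)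
pose M := (N - j.+2)%N.
have symbE j' : alg ygen (symb 0 j') <-> alg ygen (eps (oN j') (oN 0)).
  rewrite /symb /=; split; last exact: alg_scale.
  by move=> /(alg_scale ((-1) ^+ odd j')); rewrite scalerA -signr_addb addbb scale1r.
apply/symbE.
have piv : alg ygen (pivot 0)`_M.
  by apply: alg_gen; left; exists j.+2, 0%N; rewrite jN.
rewrite pivot_rec // coef_sum in piv.
have jj : (j.+1 \in index_iota 0 N) by rewrite mem_index_iota.
rewrite (bigD1_seq _ jj) ?iota_uniq //= in piv.
set rest := (X in alg _ (_ + X)) in piv.
have top : (amat 0 j.+1 (pivot j.+2))`_M = symb 0 j.+1.
  by rewrite /amat /= add0r coefZ pivot_top // eqxx mulr1.
rewrite top in piv.
suff rA : alg ygen rest.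
  by rewrite -[symb 0 j.+1](addrK rest); apply: alg_add => //; exact: alg_opp.
rewrite /rest big_seq_cond; apply: alg_sum => j' /andP[]; rewrite mem_index_iota => /andP[_ j'N] j'j.
have pj m : alg ygen (pivot j'.+1)`_m by apply: (@lowcol_ygen j'.+1) => //; exact: pivot_alg.
rewrite /amat coefD; apply: alg_add.
  case: eqP => _; last by rewrite coef0; exact: alg0.
  rewrite coef_opDp; apply: alg_add; first exact: (@alg_iterD 1).
  case: (M) => [|m]; first exact: alg0.
  exact: (alg_spow true ygen_homog).
rewrite coefZ; have [lt|ge] := ltnP j' j.+1.
  by apply: alg_mul => //; apply/symbE/IH.
have gt : (j.+1 < j')%N by rewrite ltn_neqAle eq_sym j'j.
rewrite (@pivot_top K n j'.+1 j'N); last by rewrite /M; lia.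
rewrite (_ : (M == (N - j'.+1)%N) = false) ?mulr0; first exact: alg0.
by apply/negP => /eqP; rewrite /M; lia.
Qed.

Lemma mon_ygen b m : ~~ nbas b -> alg ygen (mon [:: (b, m)]).
Proof.
move=> nb; rewrite -iter_D_gen; apply: alg_iterD.
have epsA (i j : 'I_N) : (i <= j)%N -> alg ygen (eps j i).
  by move=> ij; rewrite -(oNK i) -(oNK j); apply: eps_ygen; rewrite ij ltn_ord.
case: b nb => [[[i j] ij] /= nij|k _].
  by rewrite -(@eps_offdiag K n i j ij); apply: epsA; rewrite leqNgt.
rewrite -ell_slmat -(ppr_id (@str_slmat K n (inr k))) ell_pprD.
by apply: alg_add; exact: epsA.
Qed.

(** Since [rho] maps onto V(p-bar), this says that [ygen] generates V(p-bar). *)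
Lemma rho_ygen x : alg ygen (rho x).
Proof.
elim/(@spW K (Bsl n) psl): x => [|c u x IHx]; first by rewrite slrho0; exact: alg0.
rewrite slrhoD slrhoZ; apply: alg_add => //; apply: alg_scale.
elim: u => [|g u IH]; first by rewrite mon0 slrho1; exact: alg1.
rewrite mon_cons slrhoM; apply: alg_mul => //.
rewrite (rho_gen _ (@fcoef_par K n)) /redgen; case: ifP => [_|/negbT nb].
  exact: alg_scalar.
by case: g nb => b m; exact: mon_ygen.
Qed.

End Generators.

(** * Descent *)

Section Descent.
Variables (K : numFieldType) (n : nat).
Notation N := (NN n).
Notation psl := (@psl n).
Notation R := (spoly K psl).
Notation mon := (@mon K (Bsl n) psl).
Notation D := (@D K (Bsl n) psl).
Notation rho := (@rho K (Bsl n) psl (@nbas n) (@fcoef K n)).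
Notation del := (@rder K (Bsl n) psl (@nbas n) (@fcoef K n) (@slbr K n) (@slform K n)).
Notation symb := (@symb K n).
Notation pivot := (@pivot K n).
Notation oN := (oN n).
Notation yv := (@yv K n).
Notation wgen := (@wgen K n).
Notation valid := (valid n).

Lemma symb_above (i j : nat) : (j.+1 < i)%N -> symb i j = 0.
Proof. by move=> ji; rewrite /symb leqNgt (ltnW ji) (gtn_eqF ji). Qed.

Lemma symb_subdiag (j : nat) : symb j.+1 j = -1.
Proof. by rewrite /symb ltnn eqxx. Qed.

Section Weights.
Variables (k l : 'I_N) (kl : k != l).
Notation a := (inl (exist _ (k, l) kl) : Bsl n).

(** A weight count: $D^m\bar e_{ji}$ has weight $j-i+m+1$ in units of 1/2, and the $\chi^c$
    coefficient of the bracket with $e_{kl}$ lowers it by $l-k+c$. A negative weight forces 0. *)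
Lemma del_symb_big (c i j : nat) : (i <= j < N)%N ->
  (j.+1 + k < i + l + c)%N -> del a c (symb i j) = 0.
Proof.
move=> ij lt; have /andP[ij' _] := ij; case: c lt => [|c] lt.
  rewrite del0_symb //; have [lj|_] := eqVneq (nat_of_ord l) j.
    have [ki|_] := eqVneq (nat_of_ord k) i; first by lia.
    rewrite symb_above ?scaler0 ?scale0r ?subr0 //; lia.
  have [ki|_] := eqVneq (nat_of_ord k) i; last by rewrite !scale0r subr0.
  rewrite (@symb_above l) ?scaler0 ?scale0r ?subr0 //; lia.
rewrite delS_symb //; case: ifP => // /and3P[/eqP c0 /eqP lj /eqP ki]; lia.
Qed.

Lemma del_iterD_symb_big (m c i j : nat) : (i <= j < N)%N ->
  (j.+1 + k + m < i + l + c)%N -> del a c (iter m D (symb i j)) = 0.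
Proof.
move=> ij; elim: m c => [|m IH] c lt; first by apply: del_symb_big => //; lia.
rewrite /= del_D IH ?D0; last by lia.
by case: c lt => [|c] lt /=; rewrite ?IH ?subr0 ?scaler0 //; lia.
Qed.

(** At resulting weight exactly 0, the term of [del_D] in which $D$ acts last involves an element of
    negative weight and vanishes. So each $D$ just lowers the power of $\chi$ by one, up to sign. *)
Lemma del_iterD_symb (m c i j : nat) : (i <= j < N)%N ->
  (j.+1 + k + m = i + l + c)%N -> exists b : bool,
  del a c (iter m D (symb i j)) =
    (-1) ^+ b *: (if (m <= c)%N then del a (c - m) (symb i j) else 0).
Proof.
move=> ij; elim: m c => [|m IH] c E; first by exists false; rewrite subn0 scale1r.
rewrite /= del_D del_iterD_symb_big //; last by lia.
case: c E => [|c] E; first by exists false; rewrite D0 subr0 !scaler0.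
have [|b Eb] := IH c; first by lia.
exists (~~ ((psl a (+) odd c.+1) (+) b)).
by rewrite D0 sub0r /prevc Eb ltnS subSS scalerN scalerA -signr_addb signrN scaleNr.
Qed.

End Weights.

(* The conformal weight in units of 1/2, shifted by one; truncation is harmless
   because i <= j for valid triples. *)
Definition wt (t : nat * nat * nat) : nat := (t.1.2 - t.1.1 + t.2)%N.
Definition yle (t t' : nat * nat * nat) : bool :=
  (wt t < wt t')%N || ((wt t == wt t') && (t'.1.1 <= t.1.1)%N).

Lemma yle_total : total (fun t t' => yle t' t).
Proof. by move=> t t'; rewrite /yle; lia. Qed.

Lemma yle_trans : transitive (fun t t' => yle t' t).
Proof. by move=> t t' t''; rewrite /yle; lia. Qed.

(* The coefficient of chi^m in the bracket with e_(i-1)j sends the generator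
   (i, j, m) to a nonzero constant and kills all the generators below it. *)
Section Dual.
Variables (i j m : nat).
Hypothesis v : valid (i, j, m).

Lemma dual_subproof : oN i.-1 != oN j.
Proof.
move: v; rewrite /valid /= => /and3P[i0 ij jN].
rewrite -val_eqE /= !oN_val //; lia.
Qed.

Definition dual : Bsl n := inl (exist _ (oN i.-1, oN j) dual_subproof).

Lemma dual_nbas : nbas dual.
Proof.
move: v; rewrite /valid /= => /and3P[i0 ij jN].
rewrite !oN_val //; lia.
Qed.

(** The derivation takes the generator to a constant, so the two have equal parity; [alg_elim] uses
    one boolean for both. *)
Lemma dual_par : psl dual (+) odd m = ~~ (odd j (+) odd i) (+) odd m.
Proof.
move: v; rewrite /valid /= => /and3P[i0 ij jN].
rewrite /par !oN_val //; last by lia.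
by case: i i0 {ij} => //= i' _; case: (odd i') (odd j) (odd m) => -[] [].
Qed.

Lemma dual_self : exists c : K, c != 0 /\ del dual m (yv (i, j, m)) = c *: 1.
Proof.
have /and3P[i0 ij jN] := v; rewrite /= in i0 ij jN.
have vi : oN i.-1 = i.-1 :> nat by rewrite oN_val //; lia.
have vj : oN j = j :> nat by rewrite oN_val.
have [||b] := @del_iterD_symb (oN i.-1) (oN j) dual_subproof m m i j.
- by rewrite ij.
- by rewrite vi vj; lia.
rewrite leqnn subnn del0_symb ?ij // vi vj eqxx scale1r.
have -> : (i.-1 == i) = false by apply/negP => /eqP; lia.
(* This is where the constant comes from: the commutator contains $e_{i-1,i}$, on which $(f|\cdot)$
   is nonzero. It requires $i>0$. *)
have -> : symb i i.-1 = -1 by rewrite -{1}(prednK i0); exact: symb_subdiag.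
rewrite scale0r subr0 => E; exists (- ((-1) ^+ b * (-1) ^+ ((odd i.-1 (+) odd j) && (odd i (+) odd j)))).
split; first by rewrite oppr_eq0 mulf_eq0 !signr_eq0.
by rewrite /dual E scalerA scalerN scaleNr.
Qed.

(** Smaller weight leads to negative weight. At equal weight a nonzero value needs $i'=i-1$,
    excluded because the order puts larger columns lower ($i'\ge i$), or $j'=j$ and $m'=m$, which
    gives the same triple. *)
Lemma dual_lower t : valid t -> t != (i, j, m) -> yle t (i, j, m) ->
  del dual m (yv t) = 0.
Proof.
have /and3P[i0 ij jN] := v; rewrite /= in i0 ij jN.
have vi : oN i.-1 = i.-1 :> nat by rewrite oN_val //; lia.
have vj : oN j = j :> nat by rewrite oN_val.
case: t => -[i' j'] m' /and3P[/= i0' ij' jN'] ne; rewrite /yle /wt /=.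
case/orP=> [lt|/andP[/eqP eqw ii]].
  by apply: del_iterD_symb_big; rewrite ?ij' // vi vj /=; lia.
have [||b] := @del_iterD_symb (oN i.-1) (oN j) dual_subproof m' m i' j'.
- by rewrite ij'.
- by rewrite vi vj; lia.
move=> ->; case: leqP => [mm|_]; last by rewrite scaler0.
case e : (m - m')%N => [|c].
  rewrite del0_symb ?ij' // vi vj.
  have -> : (i.-1 == i') = false by apply/negP => /eqP; lia.
  have -> : (j == j') = false.
    apply/negP => /eqP jj; case/eqP: ne; congr (_, _, _); lia.
  by rewrite !scale0r subr0 scaler0.
rewrite delS_symb ?ij' // vi vj.
have -> : (i.-1 == i') = false by apply/negP => /eqP; lia.
by rewrite !andbF scaler0.
Qed.

End Dual.

Definition invariant (x : R) := forall a c, nbas a -> del a c x = 0.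

Definition ylist (L : seq (nat * nat * nat)) (x : R) :=
  wgen x \/ exists2 t, t \in L & x = yv t.

Lemma ylist_homog L : all valid L -> homogenous (ylist L).
Proof.
move=> aL x [/wgen_homog //|[t /(allP aL) v ->]]; eexists; exact: yv_homog.
Qed.

Lemma ylist_fixed L x : all valid L -> ylist L x -> rho x = x.
Proof.
move=> aL [/wgen_fixed //|[t /(allP aL) v ->]]; exact: yv_fixed.
Qed.

Lemma descent L x : sorted (fun t t' => yle t' t) L -> uniq L -> all valid L ->
  alg (ylist L) x -> invariant x -> alg wgen x.
Proof.
move=> sL uL aL aLx inv; elim: L sL uL aL aLx => [|y L IH] sL uL aL aLx.
  by apply: alg_sub aLx => z [|[t]] // wz; exact: alg_gen.
have /= /andP[ynL uL'] := uL; have /= /andP[vy aL'] := aL.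
apply: IH => //; first exact: path_sorted sL.
have := sL; rewrite (sorted_pairwise yle_trans) /= => /andP[/allP yL _].
case: y vy ynL aLx yL {sL uL aL} => -[i j] m vy ynL aLx yL.
have [c [c0 dy]] := dual_self vy.
(* On the subalgebra in question [rho] is the identity, which turns [delM] into the Leibniz rule
   that [alg_elim] expects. *)
have fixS z : alg (fun u => ylist L u \/ u = yv (i, j, m)) z -> rho z = z.
  move=> az; refine (alg_rho (@fcoef_par K n) _ az) => u [|->].
    exact: ylist_fixed.
  exact: yv_fixed.
apply: (@alg_elim K (Bsl n) psl (ylist L) (~~ (odd j (+) odd i) (+) odd m) (yv (i, j, m)) c
  (del (dual vy) m)) => //.
- exact: ylist_homog.
- exact: (yv_homog K vy).
- by move=> c' u z; rewrite delD delZ.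
- exact: del1.
- by move=> u z au az; rewrite delM !fixS // dual_par.
- move=> u [wu|[t tL ->]]; first by apply: wgen_invariant => //; exact: dual_nbas.
  apply: dual_lower; [exact: (allP aL')| |exact: yL].
  by apply: contraNneq ynL => <-.
- apply: alg_sub aLx => z [wz|[t]]; first by apply: alg_gen; left; left.
  rewrite inE => /predU1P[->|tL] ->; apply: alg_gen; first by right.
  by left; right; exists t.
- exact: inv (dual_nbas vy).
Qed.

(** One element involves finitely many generators; this is what lets the descent terminate. *)
Lemma ygen_list x : alg (@ygen K n) x -> exists2 L, all valid L & alg (ylist L) x.
Proof.
have wk L L' z : {subset L <= L'} -> alg (ylist L) z -> alg (ylist L') z.
  move=> LL; apply: alg_sub => u [wu|[t tL ->]]; apply: alg_gen; first by left.
  by right; exists t => //; exact: LL.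
have wkl L L' z : alg (ylist L) z -> alg (ylist (L ++ L')) z.
  by apply: wk => t tL; rewrite mem_cat tL.
have wkr L L' z : alg (ylist L) z -> alg (ylist (L' ++ L)) z.
  by apply: wk => t tL; rewrite mem_cat tL orbT.
elim=> [z [wz|[t [v ->]]]|c|u z _ [L aL Lu] _ [L' aL' Lz]|u z _ [L aL Lu] _ [L' aL' Lz]].
- by exists [::] => //; apply: alg_gen; left.
- exists [:: t]; first by rewrite /= v.
  by apply: alg_gen; right; exists t; rewrite ?mem_head.
- by exists [::] => //; exact: alg_scalar.
- exists (L ++ L'); first by rewrite all_cat aL.
  by apply: alg_add; [exact: wkl|exact: wkr].
- exists (L ++ L'); first by rewrite all_cat aL.
  by apply: alg_mul; [exact: wkl|exact: wkr].
Qed.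

Theorem invariant_wgen x : rho x = x -> invariant x -> alg wgen x.
Proof.
move=> fx inv; have [L aL Lx] : exists2 L, all valid L & alg (ylist L) x.
  by apply: ygen_list; rewrite -fx; exact: rho_ygen.
pose L' := sort (fun t t' => yle t' t) (undup L).
have mL t : (t \in L') = (t \in L) by rewrite mem_sort mem_undup.
apply: (@descent L') => //.
- exact: sort_sorted yle_total _.
- by rewrite sort_uniq undup_uniq.
- by apply/allP => t; rewrite mL => /(allP aL).
- apply: alg_sub Lx => z [wz|[t tL ->]]; apply: alg_gen; first by left.
  by right; exists t; rewrite ?mL.
Qed.

Theorem wgen_fixed_invariant x : alg wgen x -> rho x = x /\ invariant x.
Proof.
move=> ax; split; first by apply: (alg_rho (@fcoef_par K n) _ ax) => z; exact: wgen_fixed.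
move=> a c na.
apply: (alg_rder (@fcoef_par K n) (@slbr_par K n) (@slform_par K n) _ ax) => z wz.
by split; [exact: wgen_fixed|exact: wgen_invariant].
Qed.

(** * Return to formal sums *)

Lemma cls_ugen i m : cls psl (ugen K n i m) = iter m D (pivot 0)`_(N - i).
Proof.
rewrite /ugen -cls_wcoef; elim: m => //= m IH.
by rewrite cls_Dv IH.
Qed.

Lemma cls_prod (s : seq (nat * nat)) :
  cls psl (foldr (@vmul K (Bsl n)) (vone K (Bsl n)) [seq ugen K n t.1 t.2 | t <- s]) =
  foldr *%R 1 [seq iter t.2 D (pivot 0)`_(N - t.1) | t <- s].
Proof. by elim: s => [|t s IH] //=; rewrite clsM IH cls_ugen. Qed.

Lemma inGen_alg (w : Vsl K n) : inGen w <-> alg wgen (cls psl w).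
Proof.
pose U (s : seq (nat * nat)) : R := foldr *%R 1 [seq iter t.2 D (pivot 0)`_(N - t.1) | t <- s].
have UM s s' : U (s ++ s') = U s * U s'.
  by rewrite /U; elim: s => [|t s IH] /=; rewrite ?mul1r // IH mulrA.
have clsl (l : seq (K * seq (nat * nat))) : cls psl (flatten [seq vscale t.1
   (foldr (@vmul K (Bsl n)) (vone K (Bsl n)) [seq ugen K n s.1 s.2 | s <- t.2]) | t <- l])
   = \sum_(t <- l) t.1 *: U t.2.
  by rewrite cls_flatten; apply: eq_bigr => t _; rewrite clsZ cls_prod.
split=> [[l [al /clsP ->]]|].
  rewrite clsl big_seq; apply: alg_sum => t /(allP al) at2; apply: alg_scale.
  rewrite /U; elim: t.2 at2 => [_|s r IH /= /andP[s2 ar]]; first exact: alg1.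
  apply: alg_mul; last exact: IH.
  by apply: alg_gen; exists s.1, s.2.
move=> aw; suff [l [al E]] : exists l : seq (K * seq (nat * nat)),
    all (fun t => all (fun s => (2 <= s.1 <= N)%N) t.2) l /\ cls psl w = \sum_(t <- l) t.1 *: U t.2.
  by exists l; split=> //; apply/clsP; rewrite clsl.
elim: aw => [z [i [m [im ->]]]|c|u z _ [l [al ->]] _ [l' [al' ->]]|u z _ [l [al ->]] _ [l' [al' ->]]].
- exists [:: (1, [:: (i, m)])]; rewrite /= im; split=> //.
  by rewrite big_seq1 scale1r /U /= mulr1.
- by exists [:: (c, [::])]; rewrite big_seq1.
- by exists (l ++ l'); rewrite all_cat al al' big_cat.
exists [seq (t.1 * t'.1, t.2 ++ t'.2) | t <- l, t' <- l']; split.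
  apply/allP => _ /allpairsP[[t t'] [/= /(allP al) tl /(allP al') tl' ->]] /=.
  by rewrite all_cat tl tl'.
rewrite big_allpairs_dep mulr_suml; apply: eq_bigr => t _; rewrite mulr_sumr.
by apply: eq_bigr => t' _; rewrite UM -scalerAl -scalerAr scalerA.
Qed.

Lemma inJ_rho (x : Vsl K n) : inJ x <-> rho (cls psl x) = 0.
Proof.
have relE (b : Bsl n) m : nbas b -> cls psl (@vgen K (Bsl n) (b, m) ++
    (if m == 0%N then @vconst K (Bsl n) (- str (fmat K n *m slmat K b)) else [::])) =
    mon [:: (b, m)] - redgen psl (@nbas n) (@fcoef K n) (b, m).
  move=> nb; rewrite clsD /redgen /= nb; congr (_ + _).
  case: eqP => _; last by rewrite scale0r oppr0.
  by rewrite clsE /evalv big_seq1 mon0 /= scaleNr.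
have sumE (l : seq (Vsl K n * Bsl n * nat)) : all (fun t => nbas t.1.2) l ->
    cls psl (flatten [seq vmul t.1.1 (@vgen K (Bsl n) (t.1.2, t.2) ++
      (if t.2 == 0%N then @vconst K (Bsl n) (- str (fmat K n *m slmat K t.1.2)) else [::])) | t <- l])
    = \sum_(t <- l) cls psl t.1.1 * (mon [:: (t.1.2, t.2)] - redgen psl (@nbas n) (@fcoef K n) (t.1.2, t.2)).
  move=> al; rewrite cls_flatten big_seq [RHS]big_seq; apply: eq_bigr => t /(allP al) nb.
  by rewrite clsM relE.
rewrite -(idealP _ (@fcoef_par K n)); split.
  move=> [l [al /clsP ->]]; rewrite sumE //.
  exists [seq (cls psl t.1.1, (t.1.2, t.2)) | t <- l]; split; first by rewrite all_map.
  by rewrite big_map.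
move=> [l [al E]].
exists [seq (generic_quotient.repr t.1, t.2.1, t.2.2) | t <- l].
have al' : all (fun t : Vsl K n * Bsl n * nat => nbas t.1.2)
  [seq (generic_quotient.repr t.1, t.2.1, t.2.2) | t <- l] by rewrite all_map.
split=> //; apply/clsP; rewrite sumE // E big_map; apply: eq_bigr => -[r [b m]] _ /=.
by rewrite /cls reprK.
Qed.

Lemma isW_invariant (w : Vsl K n) : isW w <-> invariant (cls psl w).
Proof.
split=> H a.
  move=> c na; rewrite /rder -(cls_brV (@slbr_par K n) (@slform_par K n)).
  by apply/inJ_rho; exact: H.
by move=> na c; apply/inJ_rho; rewrite (cls_brV (@slbr_par K n) (@slform_par K n)); exact: H.
Qed.

Lemma inW_iff_inGen (w : Vsl K n) : (inVp w /\ isW w) <-> inGen w.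
Proof.
rewrite inGen_alg isW_invariant.
have -> : inVp w <-> rho (cls psl w) = cls psl w by exact: inVp_rho (@fcoef_par K n) w.
split=> [[fw iw]|/wgen_fixed_invariant //]; exact: invariant_wgen.
Qed.

End Descent.

Theorem mainTheorem4 (K : numClosedFieldType) (n : nat) :
  (1 <= n)%N ->
  forall w : Vsl K n, (inVp w /\ isW w) <-> inGen w.
Proof. by move=> _ w; exact: inW_iff_inGen. Qed.
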